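(* Let $\eta$ be a simple max-stable process on $\mathcal{X}$ with the spectral representation given in the context. For $s_1,\ldots,s_k\in\mathcal{X}$, $k\ge2$, the extremal concurrence probability satisfies $$p(s_1,\ldots,s_k)=\sum_{r=1}^k(-1)^r\sum_{\substack{J\subseteq\{1,\ldots,k\}\\|J|=r}}\mathbb{E}_{\tilde\eta}\left[\log\mathbb{P}_\eta\left\{\eta(s_j)\le\tilde\eta(s_j),\ j\in J\right\}\right],$$ where $\tilde\eta$ is an independent copy of $\eta$, $\mathbb{P}_\eta$ denotes probability with respect to $\eta$ only (with $\tilde\eta$ held fixed), and $\mathbb{E}_{\tilde\eta}$ denotes expectation with respect to $\tilde\eta$. In particular, when $k=2$, $$p(s_1,s_2)=2+\mathbb{E}_{\tilde\eta}\left[\log\mathbb{P}_\eta\left\{\eta(s_j)\le\tilde\eta(s_j),\ j=1,2\right\}\right].$$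
   Context: $\mathcal{X}\subset\mathbb{R}^d$, $d\ge1$, is a compact set. Simple max-stable process: $\eta(s)=\max_{i\ge1}\zeta_iY_i(s)=\max_{\varphi\in\Phi}\varphi(s)$, $s\in\mathcal{X}$, where $\{\zeta_i\colon i\ge1\}$ are the points of a Poisson process on $(0,\infty)$ with intensity $\zeta^{-2}\,d\zeta$, the $Y_i$ are independent copies (independent of $\{\zeta_i\}$) of a non-negative stochastic process $Y$ on $\mathcal{X}$ with continuous sample paths, $\mathbb{E}\{Y(s)\}=1$ for all $s\in\mathcal{X}$ and $\mathbb{E}\{\sup_{s\in\mathcal{X}}Y(s)\}<\infty$; $\Phi=\{\varphi_i=\zeta_iY_i\colon i\ge1\}$. Extremal concurrence probability: $p(s_1,\ldots,s_k)=\mathbb{P}\{\text{for some }\ell\ge1\colon \eta(s_j)=\varphi_\ell(s_j),\ j=1,\ldots,k\}$. *)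

(* Defs.v *)
From mathcomp Require Import all_boot all_order all_algebra finmap.
From mathcomp Require Import all_classical all_reals all_analysis measurable_realfun.

Set Implicit Arguments.
Unset Strict Implicit.
Unset Printing Implicit Defensive.

Import Order.TTheory GRing.Theory Num.Theory.
Import numFieldNormedType.Exports.

Local Open Scope classical_set_scope.
Local Open Scope ring_scope.
Local Open Scope ereal_scope.

(* A stochastic process indexed by X : set S is a map Z : T -> S -> U sending
   an outcome w to the path Z w; values of a path outside X are irrelevant. *)

Definition is_process (S : Type) (d : measure_display) (T : measurableType d)
    (d' : measure_display) (U : measurableType d')
    (X : set S) (Z : T -> S -> U) : Prop :=
  forall s, X s -> measurable_fun [set: T] (fun w => Z w s).

(* The product sigma-algebra of U^X, as a sigma-algebra on S -> U. *)
Definition cylinder (S : Type) (d' : measure_display) (U : measurableType d')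
    (X : set S) : set (set (S -> U)) :=
  <<s [set C | exists2 s, X s &
         exists2 B : set U, measurable B & C = [set f | B (f s)]] >>.

Definition process_sigma (S T : Type) (d' : measure_display)
    (U : measurableType d') (X : set S) (Z : T -> S -> U) : set (set T) :=
  preimage_set_system [set: T] Z (@cylinder S d' U X).

Definition same_law (R : realType) (S : Type)
    (d1 d2 d' : measure_display) (T1 : measurableType d1)
    (T2 : measurableType d2) (U : measurableType d')
    (P1 : probability T1 R) (P2 : probability T2 R)
    (X : set S) (Z1 : T1 -> S -> U) (Z2 : T2 -> S -> U) : Prop :=
  forall C, @cylinder S d' U X C -> P1 (Z1 @^-1` C) = P2 (Z2 @^-1` C).

Definition mutually_independent (R : realType) (d : measure_display)
    (T : measurableType d) (P : probability T R) (I : choiceType)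
    (F : I -> set (set T)) : Prop :=
  forall (J : {fset I}) (A : I -> set T),
    (forall i, i \in J -> F i (A i)) ->
    P (\bigcap_(i in [set` J]) A i) = \prod_(i <- J) P (A i).

Definition independent_copy (R : realType) (S : Type) (d d' : measure_display)
    (T : measurableType d) (U : measurableType d') (P : probability T R)
    (X : set S) (Z Z' : T -> S -> U) : Prop :=
  [/\ is_process X Z',
      same_law P P X Z' Z &
      mutually_independent P
        (fun b : bool => process_sigma X (if b then Z else Z'))].

Definition count_points (R : realType) (T : Type) (zeta : T -> nat -> R)
    (B : set R) (w : T) : \bar R :=
  \sum_(i <oo) \d_(zeta w i) B.

(* The points of a Poisson process on D with intensity measure mu, enumerated
   as a random sequence.  A Poisson variable with infinite mean is +oo a.s.
   [poisson_prob] is used rather than [poisson_pmf], whose value at rate 0 is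
   not a probability mass function; its second argument is a dummy. *)
Record is_poisson_process (R : realType) (d : measure_display)
    (T : measurableType d) (P : probability T R)
    (D : set R) (mu : set R -> \bar R) (zeta : T -> nat -> R) : Prop := {
  poisson_points : is_process [set: nat] zeta;
  poisson_support : forall w i, D (zeta w i);
  poisson_counts_finite : forall B : set R, measurable B -> B `<=` D ->
    mu B < +oo -> forall n : nat,
    P [set w | count_points zeta B w = n%:R%:E]
      = poisson_prob (fine (mu B)) 0 [set n];
  poisson_counts_infinite : forall B : set R, measurable B -> B `<=` D ->
    mu B = +oo -> P [set w | count_points zeta B w = +oo] = 1;
  poisson_counts_independent : forall (m : nat) (B : 'I_m -> set R),
    (forall j, measurable (B j)) -> (forall j, B j `<=` D) ->
    trivIset [set: 'I_m] B ->
    mutually_independent P (fun j : 'I_m =>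
      preimage_set_system [set: T] (count_points zeta (B j))
        measurable) }.

Definition inv_sq_measure (R : realType) (B : set R) : \bar R :=
  \int[lebesgue_measure]_(z in B) (z ^- 2)%:E.

Definition nonneg_continuous_process (R : realType) (n : nat)
    (d : measure_display) (T : measurableType d) (X : set 'rV[R]_n)
    (Y : T -> 'rV[R]_n -> R) : Prop :=
  [/\ is_process X Y,
      forall w s, X s -> (0 <= Y w s)%R &
      forall w, {within X, continuous (Y w)}].

(* (zeta_i) and (Y_i), living on (T, P), are the ingredients of the spectral
   representation; Y is the process on (T0, P0) of which the Y_i are copies. *)
Record spectral_representation (R : realType) (n : nat) (X : set 'rV[R]_n)
    (d0 : measure_display) (T0 : measurableType d0) (P0 : probability T0 R)
    (Y : T0 -> 'rV[R]_n -> R)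
    (d : measure_display) (T : measurableType d) (P : probability T R)
    (zeta : T -> nat -> R) (Ys : nat -> T -> 'rV[R]_n -> R) : Prop := {
  spectral_process : nonneg_continuous_process X Y;
  spectral_mean : forall s, X s -> \int[P0]_w (Y w s)%:E = 1;
  spectral_sup : \int[P0]_w ereal_sup [set (Y w s)%:E | s in X] < +oo;
  spectral_poisson :
    is_poisson_process P [set z | (0 < z)%R] (@inv_sq_measure R) zeta;
  spectral_copies : forall i, nonneg_continuous_process X (Ys i) /\
    same_law P P0 X (Ys i) Y;
  spectral_independent : mutually_independent P (fun o : option nat =>
    if o is Some i then process_sigma X (Ys i)
    else process_sigma [set: nat] zeta) }.

Definition spectral_fun (R : realType) (n : nat) (T : Type)
    (zeta : T -> nat -> R) (Ys : nat -> T -> 'rV[R]_n -> R)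
    (i : nat) (w : T) (s : 'rV[R]_n) : R :=
  (zeta w i * Ys i w s)%R.

(* Under [spectral_representation] the supremum is, on an event of probability
   one, finite and attained for every s in X, i.e., a maximum.  Taking it in
   \bar R avoids a junk value on the complementary null event. *)
Definition max_process (R : realType) (n : nat) (T : Type)
    (phi : nat -> T -> 'rV[R]_n -> R) (w : T) (s : 'rV[R]_n) : \bar R :=
  ereal_sup [set (phi i w s)%:E | i in [set: nat]].

Definition concurrence_prob (R : realType) (n : nat) (d : measure_display)
    (T : measurableType d) (P : probability T R)
    (phi : nat -> T -> 'rV[R]_n -> R) (eta : T -> 'rV[R]_n -> \bar R) (k : nat)
    (s : 'I_k -> 'rV[R]_n) : \bar R :=
  P [set w | exists l, forall j, eta w (s j) = (phi l w (s j))%:E].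

(* E_{eta'} [log P_eta {eta(s_j) <= eta'(s_j), j in J}]: the inner probability
   is over w only, with the path eta' w' held fixed.  [lne] takes the value
   -oo at 0. *)
Definition expected_log_prob (R : realType) (n : nat) (d : measure_display)
    (T : measurableType d) (P : probability T R)
    (eta eta' : T -> 'rV[R]_n -> \bar R) (k : nat) (s : 'I_k -> 'rV[R]_n)
    (J : {set 'I_k}) : \bar R :=
  \int[P]_w' lne (P [set w | forall j, j \in J -> eta w (s j) <= eta' w' (s j)]).

(* Main.v *)
(* Condition on the marks: given [zeta], the points [phi_i = (zeta_i, Y_i)] have
   independent marks, so [E prod_i h(phi_i)] is a Laplace functional of [zeta],
   which the Poisson counts evaluate on step functions. This gives
   [E prod_i h(phi_i) = exp(- int (1 - h) dm)] for the intensity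
   [m = z^-2 dz \x law(Y)]. Taking [h = 1_B] yields
   [P(phi_i in B for all i) = exp(- m(B^c))], and the first-order term in [t] of
   [h = 1_B + t 1_A] yields
   [P(one phi_l in A, all others in B) = m(A) exp(- m(B^c))].
   Cutting the values at the sites into dyadic cells and refining, the
   probability that some [phi_l] strictly dominates all the others at the sites
   [s_j] is the measure, under the law of [eta'] times [m], of the pairs
   [(eta', (z, f))] with [eta' (s_j) < z f(s_j)] for all [j]. For a single site
   this measure is [E (1 / eta'(s)) = 1], so that at each site the maximum is
   almost surely attained once and concurrence is strict domination.
   The same void probability shows that [- E log P(eta <= eta' on J)] is the
   measure of the union over [j] in [J] of these exceedance sets, and the
   statement is the inclusion-exclusion formula for their intersection. *)
Require Import Defs.
From HB Require Import structures.
From mathcomp Require Import all_boot all_order all_algebra finmap.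
From mathcomp Require Import all_classical all_reals all_analysis measurable_realfun.
From mathcomp Require Import ring lra.

Import Order.TTheory GRing.Theory Num.Theory.
Import numFieldNormedType.Exports.

Local Open Scope classical_set_scope.
Local Open Scope ring_scope.
Local Open Scope ereal_scope.

Set Implicit Arguments.
Unset Strict Implicit.

(** * Independence *)

(** The enumeration of [zeta] is arbitrary, so the first [N] points have no known law: only counts
    over the whole sequence do. Hence every formula for the process is a limit in [N] of integrals
    of finite products, and limits are exchanged by monotonicity alone, which also covers sets of
    infinite intensity. The one-point formula speaks of fixed disjoint sets [A] and [B], whereas in
    the event that one point beats all the others the bound on the others depends on the winning
    point itself. Dyadic cells remove this dependence: within a cell the bound is the left end
    point, which is deterministic. So the independent copy enters as a substitute for the competing
    points, and the sum over cells becomes the [P \x m] measure of a union of rectangles. The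
    logarithm in the statement undoes the exponential of the void probability for a frozen path of
    [eta'], and integration over that path gives the same product measure [P \x m]. Both sides thus
    compare measures of sets on one space. *)

Section joint_independence.
Context d (T : measurableType d) (R : realType) (P : probability T R).
Variables (I : choiceType) (F : I -> set (set T)).
Hypothesis mF : forall i, F i `<=` measurable.
Hypothesis sF : forall i, sigma_algebra setT (F i).
Hypothesis indF : mutually_independent P F.

(** A generating pi-system for the sigma-algebra jointly generated by the [F j], [j] in [J]. The
    family [A] is total; its values outside [J] do not affect the intersection. *)
Definition joint_events (J : {fset I}) : set (set T) :=
  [set C | exists2 A : I -> set T, (forall j, F j (A j)) &
    C = \bigcap_(j in [set` J]) A j].

Let FT i : F i setT.
Proof. by have [F0 FC _] := sF i; rewrite -(setD0 setT); apply: (FC). Qed.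

Let FI i : setI_closed (F i).
Proof.
move=> A B FA FB; have [F0 FC FU] := sF i.
have -> : A `&` B = setT `\` (\bigcup_n bigcup2 (setT `\` A) (setT `\` B) n).
  by rewrite bigcup2E !setTD setCU !setCK.
by apply: (FC); apply: FU => -[|[|n]]//=; apply: (FC).
Qed.

Lemma joint_events_measurable J : joint_events J `<=` measurable.
Proof.
move=> _ [A FA ->]; apply: fin_bigcap_measurable => // j _.
exact: mF (FA j).
Qed.

Lemma joint_events_sub J i : i \in J -> F i `<=` <<s joint_events J >>.
Proof.
move=> iJ B FB; apply: sub_sigma_algebra.
exists (fun j => if j == i then B else setT).
  by move=> j; case: eqP => // ->.
rewrite (bigcap_setD1 i)//= eqxx [X in _ `&` X]bigcapT ?setIT// => j [_ /eqP].
by move/negbTE => ->.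
Qed.

(** As functions of [A], both sides are finite measures: [P] restricted to [B], and [P] scaled by
    [P B]. They agree on the pi-system [joint_events J], hence on the sigma-algebra it generates. *)
Lemma independent_joint_events J i A B : i \notin J ->
  <<s joint_events J >> A -> F i B -> P (A `&` B) = P A * P B.
Proof.
move=> iJ sA FB; have mB := mF FB.
have PB : 0 <= P B by [].
have fPB : P B \is a fin_num by rewrite fin_num_measure.
pose c : {nonneg R} := NngNum (fine_ge0 PB).
transitivity (mrestr P mB A) => //.
transitivity (mscale c P A); last by rewrite /mscale/= fineK// muleC.
apply: (@g_sigma_algebra_measure_unique _ R T (joint_events J)
  (@joint_events_measurable J) (fun=> setT)) => //.
- move=> _; exists (fun=> setT) => //.
  by rewrite bigcapT.
- by rewrite bigcup_const.
- move=> _ _ [A1 FA1 ->] [A2 FA2 ->]; exists (fun j => A1 j `&` A2 j).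
    by move=> j; exact: FI.
  by rewrite bigcapI.
- move=> _ [A1 FA1 ->].
  rewrite /= /mscale /mrestr /= fineK// (indF (fun j _ => FA1 j)).
  pose A' j := if j == i then B else A1 j.
  have := @indF (i |` J)%fset A'.
  have A'i : A' i = B by rewrite /A' eqxx.
  rewrite big_fsetU1//= A'i => H.
  transitivity (P (\bigcap_(j in [set` (i |` J)%fset]) A' j)).
    congr (P _); apply/seteqP; split => w /=.
      move=> [wA wB] j /=; rewrite !inE /A'; case: eqP => //= _ jJ; exact: wA.
    move=> wA; split.
      move=> j /= jJ; have := wA j; rewrite /= !inE jJ orbT /A' => /(_ isT).
      by case: eqP => // ji; move: iJ; rewrite -ji jJ.
    by have := wA i; rewrite /= !inE eqxx /A' eqxx; exact.
  rewrite H; last by move=> j _; rewrite /A'; case: eqP => // ->.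
  congr (_ * _); rewrite big_seq [RHS]big_seq; apply: eq_bigr => j jJ.
  by rewrite /A'; case: eqP => // ji; move: iJ; rewrite -ji jJ.
- by move=> _; rewrite /= /mrestr setTI (le_lt_trans (probability_le1 P mB))// ltry.
Qed.

End joint_independence.

Section independent_pair.
Context d d1 d2 (T : measurableType d) (T1 : measurableType d1)
  (T2 : measurableType d2) (R : realType) (P : probability T R).
Variables (X1 : T -> T1) (X2 : T -> T2).
Hypotheses (mX1 : measurable_fun setT X1) (mX2 : measurable_fun setT X2).
Hypothesis indX : forall A B, measurable A -> measurable B ->
  P (X1 @^-1` A `&` X2 @^-1` B) = P (X1 @^-1` A) * P (X2 @^-1` B).

(** Independence on rectangles makes the law of the pair the product of the two laws, and Tonelli
    applies to it. *)
Lemma ge0_integral_independent_pair (f : T1 * T2 -> \bar R) :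
  measurable_fun setT f -> (forall x, 0 <= f x) ->
  \int[P]_w f (X1 w, X2 w) = \int[P]_w \int[P]_w' f (X1 w, X2 w').
Proof.
move=> mf f0.
pose X1m : {mfun T >-> T1} := HB.pack X1 (isMeasurableFun.Build _ _ _ _ _ mX1).
pose X2m : {mfun T >-> T2} := HB.pack X2 (isMeasurableFun.Build _ _ _ _ _ mX2).
pose X (w : T) : T1 * T2 := (X1 w, X2 w).
have mX : measurable_fun setT X by apply: measurable_fun_pair.
pose Xm : {mfun T >-> (T1 * T2)%type} :=
  HB.pack X (isMeasurableFun.Build _ _ _ _ _ mX).
transitivity (\int[distribution P Xm]_z f z).
  by rewrite ge0_integral_distribution.
transitivity (\int[distribution P X1m \x distribution P X2m]_z f z).
  apply: eq_measure_integral => A mA _.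
  exact/esym/product_measure_unique.
rewrite fubini_tonelli1// ge0_integral_distribution//=; last 2 first.
- exact: measurable_fun_fubini_tonelli_F.
- by move=> x; apply: integral_ge0.
apply: eq_integral => w _; rewrite /fubini_F ge0_integral_distribution//.
exact: measurableT_comp.
Qed.

End independent_pair.

Section joint_integral.
Context d (T : measurableType d) (R : realType) (P : probability T R).
Variables (I : choiceType) (F : I -> set (set T)).
Hypothesis mF : forall i, F i `<=` measurable.
Hypothesis sF : forall i, sigma_algebra setT (F i).
Hypothesis indF : mutually_independent P F.

Lemma measurable_joint_events d2 (T2 : measurableType d2) (J : {fset I}) j
    (Z : T -> T2) :
  j \in J -> preimage_set_system setT Z measurable `<=` F j ->
  measurable_fun setT (Z : g_sigma_algebraType (joint_events F J) -> T2).
Proof.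
move=> jJ ZF _ B mB; apply: (joint_events_sub sF jJ).
by apply: ZF; exists B.
Qed.

(** The first variable of the pair is the identity of [T], seen as a map into [T] with the coarser
    sigma-algebra generated by [J]. So [f] may depend in any way on what [J] determines, while [Z]
    is integrated out. *)
Lemma ge0_integral_independent_joint d2 (T2 : measurableType d2) (J : {fset I})
    i (Z : T -> T2) (f : g_sigma_algebraType (joint_events F J) * T2 -> \bar R) :
  i \notin J -> preimage_set_system setT Z measurable `<=` F i ->
  measurable_fun setT f -> (forall x, 0 <= f x) ->
  \int[P]_w f (w, Z w) = \int[P]_w \int[P]_w' f (w, Z w').
Proof.
move=> iJ ZF mf f0.
have mZ : measurable_fun setT Z.
  by move=> _ B mB; apply: (@mF i); apply: ZF; exists B.
have mid : measurable_fun setT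
    (id : T -> g_sigma_algebraType (joint_events F J)).
  move=> _ B /= mB; rewrite setTI preimage_id; move: B mB.
  apply: smallest_sub; first exact: sigma_algebra_measurable.
  exact: (joint_events_measurable mF (J := J)).
rewrite (ge0_integral_independent_pair mid mZ)// => A B mA mB.
rewrite preimage_id; apply: (independent_joint_events mF sF indF iJ) => //.
by apply: ZF; exists B => //; rewrite setTI.
Qed.

End joint_integral.

Lemma integral_prod_independent d (T : measurableType d) (R : realType)
    (P : probability T R) (I : choiceType) d2 (T2 : measurableType d2)
    (X : I -> T -> T2) (g : I -> T2 -> R) (s : seq I) :
  (forall i, measurable_fun setT (X i)) ->
  mutually_independent P
    (fun i => preimage_set_system setT (X i) measurable) ->
  (forall i, measurable_fun setT (g i)) -> (forall i x, (0 <= g i x)%R) ->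
  uniq s ->
  \int[P]_w (\prod_(i <- s) g i (X i w))%:E =
  \prod_(i <- s) \int[P]_w (g i (X i w))%:E.
Proof.
move=> mX indX mg g0; set F := (fun i => _) in indX.
have mF i : F i `<=` measurable by move=> _ [B mB <-]; exact: mX.
have sF i : sigma_algebra setT (F i).
  by apply: sigma_algebra_preimage; exact: sigma_algebra_measurable.
elim: s => [_|i s IH /= /andP[is0 us]].
  rewrite big_nil; under eq_integral do rewrite big_nil.
  rewrite integral_cst// mul1e; exact: probability_setT.
pose J := [fset j in s]%fset.
have iJ : i \notin J by rewrite /J inE.
rewrite big_cons -IH//.
pose f (z : g_sigma_algebraType (joint_events F J) * T2) :=
  (\prod_(j <- s) g j (X j z.1) * g i z.2)%:E.
transitivity (\int[P]_w f (w, X i w)).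
  by apply: eq_integral => w _; rewrite /f /= big_cons mulrC.
have f0 z : 0 <= f z.
  by rewrite lee_fin mulr_ge0// prodr_ge0// => j _; exact: g0.
have mf : measurable_fun setT f.
  apply/measurable_EFinP; apply: measurable_funM; last first.
    exact: measurableT_comp.
  apply: measurable_prod => j js.
  apply: (measurableT_comp (mg j)).
  apply: (measurableT_comp (g := fst)) => //.
  apply: (measurable_joint_events (F := F) sF (j := j)) => //.
  by rewrite /J inE.
rewrite (ge0_integral_independent_joint mF sF indX iJ)//.
set c := \int[P]_w (g i (X i w))%:E.
transitivity (\int[P]_w ((\prod_(j <- s) g j (X j w))%:E * c)).
  apply: eq_integral => w _; rewrite /f /=.
  under eq_integral do rewrite EFinM.
  rewrite ge0_integralZl//.
  - by apply/measurable_EFinP; exact: measurableT_comp.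
  - by move=> *; rewrite lee_fin.
  - by rewrite lee_fin prodr_ge0.
have c0 : 0 <= c by apply: integral_ge0 => w _; rewrite lee_fin.
rewrite ge0_integralZr//; first exact: muleC.
- apply/measurable_EFinP; apply: measurable_prod => j js.
  exact: measurableT_comp.
- by move=> w _; rewrite lee_fin prodr_ge0.
Qed.

(** * Laplace functional of a Poisson process *)

Lemma bounded_cvg_integral d (T : measurableType d) (R : realType)
    (P : probability T R) (f_ : nat -> T -> R) (f : T -> R) :
  (forall n, measurable_fun setT (f_ n)) ->
  (forall n w, 0 <= f_ n w <= 1)%R ->
  (forall w, f_ n w @[n --> \oo] --> f w) ->
  \int[P]_w (f_ n w)%:E @[n --> \oo] --> \int[P]_w (f w)%:E.
Proof.
move=> mf f01 ff; apply: (@dominated_cvg _ _ _ _ _ measurableT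
  (fun n w => (f_ n w)%:E) _ (cst 1)) => //.
- by move=> n; exact/measurable_EFinP.
- by move=> w _; apply: cvg_EFin; [exact: nearW|exact: ff].
- exact: finite_measure_integrable_cst.
- move=> n w _; have /andP[f0 f1] := f01 n w.
  by rewrite /= lee_fin ger0_norm.
Qed.

(** * Generating function of a Poisson count, possibly infinite *)

Section epow.
Variable R : realType.
Implicit Types (c : R) (x : \bar R).

(* [c ^ x] for [x] a natural number or [+oo]; the value at [+oo] is the limit
   of [c ^ n] when [0 <= c <= 1]. *)
Definition epow c x : R :=
  if pselect (exists n : nat, x = n%:R%:E) is left e then c ^+ projT1 (cid e)
  else (c == 1%R)%:R.

Lemma epow_nat c n : epow c n%:R%:E = (c ^+ n)%R.
Proof.
rewrite /epow; case: pselect => [e|[]]; last by exists n.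
case: cid => m /= [] /eqP; rewrite eqr_nat => /eqP <-//.
Qed.

Lemma epow_Nnat c x : (forall n : nat, x <> n%:R%:E) -> epow c x = (c == 1%R)%:R.
Proof. by move=> xn; rewrite /epow; case: pselect => // -[n xnE]; case: (xn n). Qed.

Lemma epow1 x : epow 1 x = 1%R.
Proof.
by rewrite /epow; case: pselect => // ?; rewrite ?expr1n// eqxx.
Qed.

Lemma epow_itv c x : (0 <= c <= 1)%R -> (0 <= epow c x <= 1)%R.
Proof.
move=> /andP[c0 c1]; rewrite /epow; case: pselect => [e|_].
  by rewrite exprn_ge0//= exprn_ile1.
by case: (c == 1%R); rewrite ?lexx ?ler01.
Qed.

(** The truncation of [epow c] to values of [x] below [n]. It is visibly measurable, and against a
    Poisson law it integrates to a partial sum of the exponential series. *)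
Let epow_partial c n x : R := (\sum_(i < n) c ^+ i * \1_[set i%:R%:E] x)%R.

Let epow_partialE c n m : epow_partial c n m%:R%:E = ((m < n)%N%:R * c ^+ m)%R.
Proof.
rewrite /epow_partial.
under eq_bigr => i _.
  rewrite indicE.
  rewrite (_ : _ \in _ = (i == m :> nat)); last first.
    apply/idP/eqP; last by move=> ->; rewrite inE.
    by rewrite inE /= => -[] /eqP; rewrite eqr_nat => /eqP ->.
  over.
rewrite -(big_mkord xpredT (fun i => c ^+ i * (i == m)%:R))%R.
case: ltnP => mn.
  rewrite (bigD1_seq m)/= ?mem_index_iota ?iota_uniq//.
  rewrite eqxx mulr1 mul1r big1 ?addr0// => i /negbTE ->.
  by rewrite mulr0.
rewrite mul0r big_nat big1// => i /andP[_ im].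
by rewrite ltn_eqF ?mulr0// (leq_trans im).
Qed.

Let epow_partial_Nnat c n x : (forall n : nat, x <> n%:R%:E) ->
  epow_partial c n x = 0%R.
Proof.
move=> xn; rewrite /epow_partial big1// => i _.
by rewrite indicE memNset ?mulr0// => /= xi; case: (xn i).
Qed.

Let epow_partial_itv c n x : (0 <= c <= 1)%R ->
  (0 <= epow_partial c n x <= 1)%R.
Proof.
move=> c01; have /andP[c0 c1] := c01.
have [[m ->]|/forallNP xn] := pselect (exists m : nat, x = m%:R%:E).
  rewrite epow_partialE; case: ltnP => _; rewrite ?mul1r ?mul0r ?lexx ?ler01//.
  by rewrite exprn_ge0//= exprn_ile1.
by rewrite epow_partial_Nnat// lexx ler01.
Qed.

Let cvg_epow_partial c x : (0 <= c < 1)%R ->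
  epow_partial c n x @[n --> \oo] --> epow c x.
Proof.
move=> /andP[c0 c1].
have [[m ->]|/forallNP xn] := pselect (exists m : nat, x = m%:R%:E).
  rewrite epow_nat; apply: cvg_near_cst; near=> n.
  by rewrite epow_partialE (_ : (m < n)%N) ?mul1r//; near: n; exact: nbhs_infty_gt.
rewrite epow_Nnat// lt_eqF//; apply: cvg_near_cst; apply: nearW => n.
exact: epow_partial_Nnat.
Unshelve. all: by end_near. Qed.

Let measurable_epow_partial c n : measurable_fun setT (epow_partial c n).
Proof.
by apply: measurable_sum => i; apply: measurable_funM.
Qed.

Lemma measurable_epow c : (0 <= c <= 1)%R -> measurable_fun setT (epow c).
Proof.
move=> /andP[c0]; rewrite le_eqVlt => /predU1P[->|c1].
  by rewrite (_ : epow 1 = cst 1%R)//; apply/funext => x; exact: epow1.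
apply: (@measurable_fun_cvg _ _ _ _ (epow_partial c)) => //.
by move=> x _; apply: cvg_epow_partial; rewrite c0.
Qed.

(** A nondecreasing integer sequence is either bounded, hence eventually equal to its maximum, or
    tends to infinity. In the second case [c ^+ K n] tends to 0 unless [c = 1], which is the value
    of [epow] at [+oo]. *)
Lemma cvg_epow c (K : nat -> nat) x : (0 <= c <= 1)%R ->
  {homo K : m n / (m <= n)%N} -> (K n)%:R%:E @[n --> \oo] --> x ->
  (c ^+ K n)%R @[n --> \oo] --> epow c x.
Proof.
move=> /andP[c0 c1] ndK Kx.
have [[M KM]|/forallNP unbK] := pselect (exists M, forall n, (K n <= M)%N).
  have exK : exists m, `[< exists n, K n = m >] by exists (K 0%N); apply/asboolP; exists 0%N.
  have bK m : `[< exists n, K n = m >] -> (m <= M)%N by move=> /asboolP[n <-].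
  case: (ex_maxnP exK bK) => m /asboolP[n0 Kn0] maxm.
  have Kc n : (n0 <= n)%N -> K n = m.
    move=> n0n; apply/eqP; rewrite eqn_leq -{2}Kn0 ndK// andbT.
    by apply: maxm; apply/asboolP; exists n.
  have -> : x = m%:R%:E.
    apply: (@cvg_unique _ _ _ _ _ _ Kx) => //.
    by apply: cvg_near_cst; exists n0 => // n /= /Kc ->.
  by rewrite epow_nat; apply: cvg_near_cst; exists n0 => // n /= /Kc ->.
have Koo : forall M, exists n0, forall n, (n0 <= n)%N -> (M < K n)%N.
  move=> M; have /existsNP[n0 /negP] := unbK M; rewrite -ltnNge => Mn0.
  by exists n0 => n /ndK; exact: leq_trans.
have xn m : x <> m%:R%:E.
  move=> xm; rewrite xm in Kx.
  have [n0 n0P] := Koo m.+1.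
  have Klim : limn (fun n => (K n)%:R%:E : \bar R) = m%:R%:E by apply/cvg_lim.
  suff : m.+1%:R%:E <= limn (fun n => (K n)%:R%:E : \bar R).
    by rewrite Klim lee_fin ler_nat ltnn.
  apply: lime_ge; first by apply/cvg_ex; exists m%:R%:E.
  by exists n0 => // n /= /n0P /ltnW; rewrite lee_fin ler_nat.
rewrite epow_Nnat//.
move: c1; rewrite le_eqVlt => /predU1P[->|c1].
  by rewrite eqxx; under eq_cvg do rewrite expr1n; exact: cvg_cst.
rewrite lt_eqF//=.
apply/cvgrPdist_lt => e e0.
have : (c ^+ n)%R @[n --> \oo] --> (0%R : R).
  by apply: cvg_expr; rewrite ger0_norm.
move=> /cvgrPdist_lt/(_ e e0)[M _ MP].
have [n0 n0P] := Koo M.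
by exists n0 => // n /= /n0P Mn; apply: MP => /=; exact: ltnW.
Qed.

Section poisson.
Context d (T : measurableType d) (P : probability T R) (N : T -> \bar R).
Hypothesis mN : measurable_fun setT N.

Let poisson_prob_set1 (rate : R) n : (0 <= rate)%R ->
  poisson_prob rate 0 [set n] = (expR (- rate) * exp_coeff rate n)%:E.
Proof.
rewrite /poisson_prob le_eqVlt => /predU1P[<-|rate0].
  rewrite ltxx diracE oppr0 expR0 mul1r /exp_coeff/= expr0n.
  case: n => [|n] /=; first by rewrite mem_set// fact0 divr1.
  by rewrite memNset ?mul0r//.
rewrite rate0 esum_set1 ?lee_fin ?poisson_pmf_ge0// /poisson_pmf rate0.
by rewrite mulrC.
Qed.

(** The exponential series at [c * rate], times [exp (- rate)]. The case [c = 1] is separate because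
    the truncations vanish at [+oo] while [epow 1] does not. *)
Lemma integral_epow_poisson c (rate : R) : (0 <= c <= 1)%R -> (0 <= rate)%R ->
  (forall n : nat, P [set w | N w = n%:R%:E] = poisson_prob rate 0 [set n]) ->
  \int[P]_w (epow c (N w))%:E = (expR (- ((1 - c) * rate)))%:E.
Proof.
move=> /andP[c0]; rewrite le_eqVlt => /predU1P[-> _ _|c1 rate0 PN].
  rewrite subrr mul0r oppr0 expR0.
  under eq_integral do rewrite epow1.
  by rewrite integral_cst// mul1e; exact: probability_setT.
have c01 : (0 <= c <= 1)%R by rewrite c0 ltW.
have : \int[P]_w (epow_partial c n (N w))%:E @[n --> \oo] -->
    \int[P]_w (epow c (N w))%:E.
  apply: bounded_cvg_integral.
  - by move=> n; exact: measurableT_comp.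
  - by move=> n w; exact: epow_partial_itv.
  - by move=> w; apply: cvg_epow_partial; rewrite c0.
move/cvg_unique; apply => //.
have mI (i : nat) : measurable_fun setT (fun w => \1_[set i%:R%:E] (N w) : R).
  apply: (measurableT_comp _ mN); apply: measurable_indic.
  exact: emeasurable_set1.
have intE n : \int[P]_w (epow_partial c n (N w))%:E =
    (expR (- rate) * series (exp_coeff (c * rate)) n)%:E.
  rewrite /epow_partial; under eq_integral do rewrite -sumEFin.
  rewrite ge0_integral_sum//; last 2 first.
  - by move=> i; apply/measurable_EFinP; apply: measurable_funM.
  - by move=> i w _; rewrite lee_fin mulr_ge0// exprn_ge0.
  rewrite /series/= mulr_sumr -sumEFin big_mkord; apply: eq_bigr => i _.
  under eq_integral do rewrite EFinM.
  have mNi : measurable (N @^-1` [set i%:R%:E]).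
    by rewrite -[X in measurable X]setTI; apply: mN => //; exact: emeasurable_set1.
  rewrite ge0_integralZl//; last 2 first.
  - by apply/measurable_EFinP; exact: mI.
  - by rewrite lee_fin exprn_ge0.
  rewrite (_ : \int[P]_w _ = P (N @^-1` [set i%:R%:E])); last first.
    by rewrite -[X in P X]setIT -integral_indic//; apply: eq_integral.
  rewrite [X in _ * X]PN poisson_prob_set1// -EFinM /exp_coeff/= exprMn.
  by congr EFin; rewrite mulrCA !mulrA.
rewrite /=; under eq_cvg do rewrite intE.
apply: cvg_EFin; first exact: nearW.
have -> : expR (- ((1 - c) * rate)) = (expR (- rate) * expR (c * rate))%R.
  by rewrite -expRD mulrBl mul1r opprB addrC.
apply: cvgMr; exact: is_cvg_series_exp_coeff.
Qed.

Lemma integral_epow_infinite c : (0 <= c < 1)%R ->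
  P [set w | N w = +oo] = 1 -> \int[P]_w (epow c (N w))%:E = 0.
Proof.
move=> /andP[c0 c1] PN.
have c01 : (0 <= c <= 1)%R by rewrite c0 ltW.
have mNy : measurable [set w | N w = +oo].
  by rewrite -[X in measurable X]setTI; apply: (mN measurableT (Y := [set +oo]));
    exact: emeasurable_set1.
rewrite (ae_eq_integral (cst 0))//.
- by rewrite integral0.
- by apply/measurable_EFinP; apply: measurableT_comp => //; exact: measurable_epow.
exists (~` [set w | N w = +oo]); split.
- exact: measurableC.
- by have := probability_setC P mNy; rewrite PN subee.
- move=> w /= h Nw; apply: h => _; rewrite Nw epow_Nnat//.
  by rewrite lt_eqF.
Qed.

End poisson.

End epow.

Section laplace_functional.
Context d (T : measurableType d) (R : realType) (P : probability T R).
Variables (D : set R) (mu : set R -> \bar R) (zeta : T -> nat -> R).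
Variable nu : {measure set R -> \bar R}.
Hypothesis pzeta : is_poisson_process P D mu zeta.
Hypothesis nuE : forall B, measurable B -> B `<=` D -> mu B = nu B.

Let mzeta i : measurable_fun setT (fun w => zeta w i).
Proof. exact: (poisson_points pzeta). Qed.

Let count_partial (B : set R) w n : nat := \sum_(i < n) (zeta w i \in B).

Let cvg_count_partial (B : set R) w :
  (count_partial B w n)%:R%:E @[n --> \oo] --> count_points zeta B w.
Proof.
rewrite /count_points.
have : cvgn (fun n => \sum_(0 <= i < n) (\d_(zeta w i) B : \bar R)).
  by apply: is_cvg_nneseries.
rewrite (_ : (fun n => \sum_(0 <= i < n) (\d_(zeta w i) B : \bar R)) =
  (fun n => (count_partial B w n)%:R%:E))//.
apply/funext => n; rewrite /count_partial big_mkord natr_sum -sumEFin.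
by apply: eq_bigr => i _; rewrite diracE.
Qed.

Lemma measurable_count_points B : measurable B ->
  measurable_fun setT (count_points zeta B).
Proof.
move=> mB; apply: (@ge0_emeasurable_sum _ _ _ _ _ xpredT) => // i _.
apply/measurable_EFinP; rewrite (_ : (fun _ => _) = \1_B \o zeta ^~ i)//.
exact: measurableT_comp.
Qed.

(** The extended conventions make one formula of three cases: with [nu B = +oo] the right-hand side
    is 0 for [c < 1], and 1 for [c = 1] since [0 * +oo = 0]. *)
Lemma integral_epow_count c B : (0 <= c <= 1)%R -> measurable B -> B `<=` D ->
  \int[P]_w (epow c (count_points zeta B w))%:E =
  expeR (- ((1 - c)%:E * nu B)).
Proof.
move=> c01 mB BD; have mN := measurable_count_points mB.
have [nuB|] := ltP (nu B) +oo.
  have fnu : nu B \is a fin_num by rewrite ge0_fin_numE.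
  rewrite (integral_epow_poisson mN (rate := fine (nu B))) ?fine_ge0//.
  - by rewrite -[in RHS](fineK fnu).
  - move=> n; rewrite -(nuE mB BD).
    by apply: (poisson_counts_finite pzeta) => //; rewrite nuE.
rewrite leye_eq => /eqP nuB.
move: c01 => /andP[c0]; rewrite le_eqVlt => /predU1P[->|c1].
  rewrite subrr mul0e oppe0 expeR0.
  under eq_integral do rewrite epow1.
  by rewrite integral_cst// mul1e; exact: probability_setT.
rewrite integral_epow_infinite ?c0//; last first.
  by apply: (poisson_counts_infinite pzeta) => //; rewrite nuE.
by rewrite nuB gt0_muley ?lte_fin ?subr_gt0.
Qed.

(** The product over points regroups as a product over [j] of [c j] to the number of points in
    [B j]; points outside every [B j] contribute 1. As [n] grows these exponents become the full
    counts, which are independent because the [B j] are disjoint. *)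
Lemma cvg_integral_prod_step m (B : 'I_m -> set R) (c : 'I_m -> R) :
  (forall j, measurable (B j)) -> (forall j, B j `<=` D) ->
  trivIset setT B -> (forall j, (0 <= c j <= 1)%R) ->
  \int[P]_w (\prod_(i < n) \prod_(j < m) c j ^+ (zeta w i \in B j))%:E
    @[n --> \oo] --> expeR (- \sum_(j < m) (1 - c j)%:E * nu (B j)).
Proof.
move=> mB BD tB c01.
have -> : expeR (- \sum_(j < m) (1 - c j)%:E * nu (B j)) =
    \int[P]_w (\prod_(j < m) epow (c j) (count_points zeta (B j) w))%:E.
  rewrite (@integral_prod_independent _ _ _ P _ _ _
    (fun j => count_points zeta (B j)) (fun j => epow (c j))).
  - transitivity (\prod_(j < m) expeR (- ((1 - c j)%:E * nu (B j)))).
      rewrite -(@big_morph _ _ expeR 1 *%E 0 +%E); last 2 first.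
      + exact: expeRD.
      + exact: expeR0.
      congr expeR; rewrite -sumeN// => i j _ _.
      by rewrite ge0_adde_def// inE mule_ge0// lee_fin subr_ge0;
        [case/andP: (c01 i)|case/andP: (c01 j)].
    by apply: eq_bigr => j _; rewrite integral_epow_count.
  - by move=> j; exact: measurable_count_points.
  - exact: (poisson_counts_independent pzeta).
  - by move=> j; exact: measurable_epow.
  - by move=> j x; case/andP: (epow_itv x (c01 j)).
  - exact: index_enum_uniq.
have prodE n w : (\prod_(i < n) \prod_(j < m) c j ^+ (zeta w i \in B j) =
    \prod_(j < m) c j ^+ count_partial (B j) w n)%R.
  by rewrite exchange_big; apply: eq_bigr => j _; rewrite expr_sum.
apply: bounded_cvg_integral.
- move=> n; apply: measurable_prod => i _; apply: measurable_prod => j _.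
  rewrite (_ : (fun _ => _) =
    (fun w => if zeta w i \in B j then c j else 1%R)).
    apply: measurable_fun_ifT => //.
    rewrite (_ : (fun _ => _) = (mem (B j)) \o zeta ^~ i)//.
    apply: measurableT_comp => //.
    apply: (@measurable_fun_bool _ _ _ _ true).
    rewrite setTI (_ : _ @^-1` _ = B j)//.
    by apply/seteqP; split => x; [exact: set_mem|exact: mem_set].
  by apply/funext => w; case: (_ \in _); rewrite ?expr1 ?expr0.
- move=> n w; rewrite prodr_ge0 => [|i _]; last first.
    by apply: prodr_ge0 => j _; rewrite exprn_ge0//; case/andP: (c01 j).
  apply: prodr_ile1 => i _; rewrite prodr_ge0 => [|j _]; last first.
    by rewrite exprn_ge0//; case/andP: (c01 j).
  apply: prodr_ile1 => j _; have /andP[c0 c1] := c01 j.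
  by rewrite exprn_ge0//= exprn_ile1.
- move=> w; under eq_cvg do rewrite prodE.
  apply: cvg_big => [|j _]; first exact: mul_continuous.
  apply: cvg_epow => //.
  by move=> p q pq; rewrite /count_partial -(subnKC pq) big_split_ord leq_addr.
Qed.

End laplace_functional.

Section dyadic_approximation.
Variables (R : realType).
Implicit Types (x : R).

Definition dyadic_floor n x : R := ((Num.truncn (2 ^+ n * x))%:R / 2 ^+ n)%R.

Let exp2_gt0 n : (0 < 2 ^+ n :> R)%R. Proof. by rewrite exprn_gt0. Qed.

Lemma dyadic_floor_itv n x : (0 <= x)%R -> (0 <= dyadic_floor n x <= x)%R.
Proof.
move=> x0; apply/andP; split; first by rewrite divr_ge0// ltW.
by rewrite ler_pdivrMr// mulrC truncn_le mulr_ge0// ltW.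
Qed.

Lemma dyadic_floor_nd x : (0 <= x)%R ->
  {homo dyadic_floor ^~ x : m n / (m <= n)%N >-> (m <= n)%R}.
Proof.
move=> x0; apply: homo_leq => // n; first exact: le_trans.
rewrite /dyadic_floor exprS invfM mulrA ler_pM2r ?invr_gt0//.
rewrite ler_pdivlMr// -natrM ler_nat truncn_ge_nat; last first.
  by rewrite !mulr_ge0// ltW.
rewrite natrM mulrC -mulrA ler_pM2l//.
by rewrite truncn_le mulr_ge0// ltW.
Qed.

Lemma cvg_dyadic_floor x : (0 <= x)%R ->
  dyadic_floor n x @[n --> \oo] --> x.
Proof.
move=> x0; apply: (@squeeze_cvgr _ _ _ _ (fun n => x - 2^-1 ^+ n)%R (fun=> x)).
- apply: nearW => n; have /andP[_ ->] := dyadic_floor_itv n x0.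
  rewrite andbT /dyadic_floor ler_pdivlMr// mulrBl -exprMn mulVf// expr1n.
  by rewrite lerBlDr mulrC ltW// natr1 truncnS_gt.
- rewrite -[X in _ --> X]subr0; apply: cvgB; first exact: cvg_cst.
  by apply: cvg_expr; rewrite ger0_norm// invf_lt1// ltr1n.
- exact: cvg_cst.
Qed.

End dyadic_approximation.

(** * From step functions to measurable functions *)

Section laplace_functional.
Context d (T : measurableType d) (R : realType) (P : probability T R).
Variables (D : set R) (mu : set R -> \bar R) (zeta : T -> nat -> R).
Variable nu : {measure set R -> \bar R}.
Hypothesis mD : measurable D.
Hypothesis pzeta : is_poisson_process P D mu zeta.
Hypothesis nuE : forall B, measurable B -> B `<=` D -> mu B = nu B.
Variable H : R -> R.
Hypothesis mH : measurable_fun setT H.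
Hypothesis H01 : forall z, (0 <= H z <= 1)%R.

Let mzeta i : measurable_fun setT (fun w => zeta w i).
Proof. exact: (poisson_points pzeta). Qed.

Let G z : R := (1 - H z)%R.
Let G01 z : (0 <= G z <= 1)%R.
Proof. by have /andP[h0 h1] := H01 z; rewrite subr_ge0 h1 gerBl. Qed.
Let G0 z : (0 <= G z)%R. Proof. by case/andP: (G01 z). Qed.
Let mG : measurable_fun setT G. Proof. exact: measurable_funB. Qed.

(** The rounding is applied to [G = 1 - H], not to [H]: the dyadic floors of [G] increase to [G], so
    their integrals converge monotonically even when the limit is [+oo]. The index runs up to
    [2 ^ n] inclusive because [G] may reach 1. *)
Let step n z : nat := Num.truncn (2 ^+ n * G z).
Let B n (j : 'I_(2 ^ n).+1) := D `&` [set z | step n z = j].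
Let c n (j : 'I_(2 ^ n).+1) : R := (1 - j%:R / 2 ^+ n)%R.

Let exp2_gt0 n : (0 < 2 ^+ n :> R)%R. Proof. by rewrite exprn_gt0. Qed.

Let step_lt n z : (step n z < (2 ^ n).+1)%N.
Proof.
rewrite /step ltnS -(ler_nat R) natrX (le_trans (_ : _ <= 2 ^+ n * G z)%R)//.
  by rewrite truncn_le mulr_ge0// ltW.
by rewrite ger_pMr//; case/andP: (G01 z).
Qed.

Let mB n j : measurable (@B n j).
Proof.
apply: measurableI => //.
rewrite (_ : [set z | _] =
  (fun z => 2 ^+ n * G z)%R @^-1` `[j%:R, j.+1%:R[%classic).
  rewrite -[X in measurable X]setTI.
  by apply: (measurable_funM _ mG) => //; exact: measurable_itv.
apply/seteqP; split => z /=; rewrite in_itv/=.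
  by move=> <-; apply: truncn_itv; rewrite mulr_ge0// ltW.
exact: truncn_def.
Qed.

Let c01 n (j : 'I_(2 ^ n).+1) : (0 <= c j <= 1)%R.
Proof.
rewrite /c subr_ge0 gerBl divr_ge0 ?(ltW (exp2_gt0 n))// andbT ler_pdivrMr// mul1r -natrX.
by rewrite ler_nat -ltnS.
Qed.

Let dyadic_step n z : D z ->
  (\sum_(j < (2 ^ n).+1) (j%:R / 2 ^+ n) * \1_(B j) z = dyadic_floor n (G z))%R.
Proof.
move=> Dz; rewrite (bigD1 (Ordinal (step_lt n z)))//= indicE mem_set// mulr1.
rewrite big1 ?addr0// => j jz; rewrite indicE memNset ?mulr0// => -[_ /= zj].
by move/eqP: jz; apply; apply/val_inj.
Qed.

Let prod_step n z : D z ->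
  (\prod_(j < (2 ^ n).+1) c j ^+ (z \in B j) = 1 - dyadic_floor n (G z))%R.
Proof.
move=> Dz; rewrite (bigD1 (Ordinal (step_lt n z)))//= mem_set// expr1.
rewrite big1 ?mulr1// => j jz; rewrite memNset ?expr0// => -[_ /= zj].
by move/eqP: jz; apply; apply/val_inj.
Qed.

Let I n := \int[nu]_(z in D) (dyadic_floor n (G z))%:E.
Let a N := \int[P]_w (\prod_(i < N) H (zeta w i))%:E.
Let b n N := \int[P]_w (\prod_(i < N) (1 - dyadic_floor n (G (zeta w i))))%:E.

Let Dzeta w i : D (zeta w i).
Proof. exact: (poisson_support pzeta). Qed.

Let integral_step n :
  I n = \sum_(j < (2 ^ n).+1) (1 - c j)%:E * nu (B j).
Proof.
transitivity (\int[nu]_(z in D)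
    \sum_(j < (2 ^ n).+1) ((j%:R / 2 ^+ n) * \1_(B j) z)%:E).
  by apply: eq_integral => z /set_mem Dz; rewrite sumEFin dyadic_step.
rewrite ge0_integral_sum//; last first.
  by move=> j; apply/measurable_EFinP; apply: measurable_funM.
apply: eq_bigr => j _; under eq_integral do rewrite EFinM.
rewrite ge0_integralZl//; last first.
  by apply/measurable_EFinP; apply: measurable_indic; exact: mB.
rewrite integral_indic//.
by congr (_ * nu _); [rewrite /c opprB addrC subrK|apply: setIidl => z []].
Qed.

Let cvg_b n : b n N @[N --> \oo] --> expeR (- I n).
Proof.
rewrite integral_step /b.
under eq_cvg => N.
  under eq_integral => w _.
    under eq_bigr do rewrite -prod_step//.
    over.
  over.
apply: (cvg_integral_prod_step pzeta nuE) => //.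
- by move=> j z [].
- by move=> i j _ _ [z [[_ /= zi] [_ /= zj]]]; apply/val_inj; rewrite /= -zi -zj.
Qed.

Let dyadic_compl_itv n z : (0 <= 1 - dyadic_floor n (G z) <= 1)%R.
Proof.
have /andP[d0 dG] := dyadic_floor_itv n (G0 z).
rewrite subr_ge0 gerBl d0 andbT (le_trans dG)//.
by case/andP: (G01 z).
Qed.

Let measurable_dyadic n : measurable_fun setT (fun z => dyadic_floor n (G z)).
Proof.
apply: (measurableT_comp _ mG); apply: nondecreasing_measurable => // x y xy.
by rewrite ler_pM2r ?invr_gt0// ler_nat le_truncn// ler_pM2l.
Qed.

Let ab N n : a N <= b n N.
Proof.
apply: ge0_le_integral => //.
- by move=> w _; rewrite lee_fin prodr_ge0// => i _; case/andP: (H01 (zeta w i)).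
- apply/measurable_EFinP; apply: measurable_prod => i _.
  exact: measurableT_comp.
- apply/measurable_EFinP; apply: measurable_prod => i _.
  by apply: measurable_funB => //; apply: (measurableT_comp (measurable_dyadic n)).
- move=> w _; rewrite lee_fin; apply: ler_prod => i _.
  case/andP: (H01 (zeta w i)) => -> _ /=.
  by rewrite lerBrDl -lerBrDr; case/andP: (dyadic_floor_itv n (G0 (zeta w i))).
Qed.

Let b_cvg_a N : b n N @[n --> \oo] --> a N.
Proof.
apply: bounded_cvg_integral.
- move=> n; apply: measurable_prod => i _.
  by apply: measurable_funB => //; apply: (measurableT_comp (measurable_dyadic n)).
- move=> n w; rewrite prodr_ge0 => [|i _]; last first.
    by case/andP: (dyadic_compl_itv n (zeta w i)).
  by apply: prodr_ile1.
- move=> w; apply: cvg_big => [|i _]; first exact: mul_continuous.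
  rewrite [X in _ --> X](_ : _ = 1 - G (zeta w i))%R; last by rewrite /G opprB addrC subrK.
  by apply: cvgB; [exact: cvg_cst|exact: cvg_dyadic_floor].
Qed.

Let prod_ni (f : R -> R) : measurable_fun setT f ->
    (forall z, (0 <= f z <= 1)%R) ->
  {homo (fun N => \int[P]_w (\prod_(i < N) f (zeta w i))%:E)
    : m n / (m <= n)%N >-> n <= m}.
Proof.
move=> mf f01 m n mn.
have mprod k : measurable_fun setT (fun w => (\prod_(i < k) f (zeta w i))%:E).
  apply/measurable_EFinP; apply: measurable_prod => i _.
  exact: measurableT_comp.
have prod0 k w : (0 <= \prod_(i < k) f (zeta w i))%R.
  by apply: prodr_ge0 => i _; case/andP: (f01 (zeta w i)).
apply: ge0_le_integral => //.
- by move=> w _; rewrite lee_fin.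
- move=> w _; rewrite lee_fin -(subnKC mn) big_split_ord/=.
  by apply: ler_piMr; [exact: prod0|exact: prodr_ile1].
Qed.

Let cvg_I : I n @[n --> \oo] --> \int[nu]_(z in D) (G z)%:E.
Proof.
have -> : \int[nu]_(z in D) (G z)%:E =
    \int[nu]_(z in D) limn (fun n => (dyadic_floor n (G z))%:E).
  apply: eq_integral => z _; apply/esym/cvg_lim => //.
  by apply: cvg_EFin; [exact: nearW|exact: cvg_dyadic_floor].
apply: cvg_monotone_convergence => //.
- move=> n; apply/measurable_EFinP; apply: measurable_funTS.
  exact: measurable_dyadic.
- by move=> n z _; rewrite lee_fin; case/andP: (dyadic_floor_itv n (G0 z)).
- by move=> z _ m n mn; rewrite lee_fin dyadic_floor_nd.
Qed.

(** A double limit of [b n N]: in [N] it gives [expeR (- I n)], in [n] it gives [a N]. Both [a] and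
    [b n] decrease in [N], with [a N <= b n N]. Hence [expeR (- I n) <= b n N] bounds every [a N]
    from below, and [alpha <= b n N] bounds [alpha] by every [expeR (- I n)]. *)
Lemma cvg_integral_prod_poisson :
  \int[P]_w (\prod_(i < N) H (zeta w i))%:E @[N --> \oo] -->
  expeR (- \int[nu]_(z in D) (1 - H z)%:E).
Proof.
have acvg := ereal_nonincreasing_cvgn (prod_ni mH H01).
set alpha := ereal_inf _ in acvg.
suff -> : expeR (- \int[nu]_(z in D) (1 - H z)%:E) = alpha by [].
have alpha0 : 0 <= alpha.
  apply/ereal_infP => _ [N _ <-]; apply: integral_ge0 => w _.
  by rewrite lee_fin prodr_ge0// => i _; case/andP: (H01 (zeta w i)).
have Inn n : I n <= \int[nu]_(z in D) (G z)%:E.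
  apply: ge0_le_integral => //.
  - by move=> z _; rewrite lee_fin; case/andP: (dyadic_floor_itv n (G0 z)).
  - by apply/measurable_EFinP; apply: measurable_funTS; exact: measurable_dyadic.
  - by apply/measurable_EFinP; apply: measurable_funTS.
  - by move=> z _; rewrite lee_fin; case/andP: (dyadic_floor_itv n (G0 z)).
apply/eqP; rewrite eq_le; apply/andP; split.
  apply/ereal_infP => _ [N _ <-].
  have -> : \int[P]_w (\prod_(i < N) H (zeta w i))%:E = limn (b ^~ N).
    by apply/esym/cvg_lim => //; exact: b_cvg_a.
  apply: lime_ge; first by apply/cvg_ex; exists (a N); exact: b_cvg_a.
  apply: nearW => n.
  apply: (@le_trans _ _ (expeR (- I n))); first by rewrite lee_expeR leeN2.
  rewrite -(cvg_lim _ (@cvg_b n))//.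
  apply: lime_le; first by apply/cvg_ex; exists (expeR (- I n)); exact: cvg_b.
  exists N => // m /= Nm.
  apply: (prod_ni _ (dyadic_compl_itv n) Nm).
  by apply: measurable_funB => //; exact: measurable_dyadic.
(* Taking logarithms turns the goal into an upper bound on every [I n], which passes to the limit
   [cvg_I] whether or not it is finite. *)
rewrite -(lneK (x := alpha)); last by rewrite in_itv/= alpha0 leey.
rewrite lee_expeR leeNr -(cvg_lim _ cvg_I)//.
apply: lime_le; first by apply/cvg_ex; eexists; exact: cvg_I.
apply: nearW => n; rewrite -leeNr -lee_expeR lneK; last first.
  by rewrite in_itv/= alpha0 leey.
rewrite -(cvg_lim _ (@cvg_b n))//.
apply: lime_ge; first by apply/cvg_ex; exists (expeR (- I n)); exact: cvg_b.
apply: nearW => N; apply: (le_trans _ (ab N n)).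
by apply: ereal_inf_lbound; exists N.
Qed.

End laplace_functional.

(** * Marked Poisson processes *)

Section process_sigma.
Context (S : Type) d (T : measurableType d) d' (U : measurableType d').
Variables (X : set S) (Z : T -> S -> U).

Lemma sigma_algebra_process_sigma : sigma_algebra setT (process_sigma X Z).
Proof.
by apply: sigma_algebra_preimage; exact: smallest_sigma_algebra.
Qed.

Lemma preimage_process_sigma s : X s ->
  preimage_set_system setT (fun w => Z w s) measurable `<=` process_sigma X Z.
Proof.
move=> Xs _ [B mB <-]; exists [set f | B (f s)] => //.
by apply: sub_sigma_algebra; exists s => //; exists B.
Qed.

Hypothesis mZ : is_process X Z.

Lemma measurable_cylinder C : cylinder X C -> measurable (Z @^-1` C).
Proof.
apply: (@smallest_sub _ _ _ [set C | measurable (Z @^-1` C)]) => //.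
  split => /=; first by rewrite preimage_set0.
    move=> A mA; rewrite setTD preimage_setC; exact: measurableC.
  by move=> F mF; rewrite preimage_bigcup; exact: bigcupT_measurable.
move=> _ [s Xs [B mB ->]] /=.
by rewrite -[X in measurable X]setTI; exact: (mZ Xs).
Qed.

Lemma process_sigma_measurable : process_sigma X Z `<=` measurable.
Proof. by move=> _ [C cC <-]; rewrite setTI; exact: measurable_cylinder. Qed.

End process_sigma.

Section marked_poisson_process.
Context d (T : measurableType d) d' (U : measurableType d') (R : realType).
Variables (P : probability T R) (Q : probability U R).
Variables (D : set R) (mu : set R -> \bar R) (zeta : T -> nat -> R).
Variables (nu : {sigma_finite_measure set R -> \bar R}) (V : nat -> T -> U).
Hypothesis mD : measurable D.
Hypothesis pzeta : is_poisson_process P D mu zeta.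
Hypothesis nuE : forall B, measurable B -> B `<=` D -> mu B = nu B.
Hypothesis nuDC : nu (~` D) = 0.
Hypothesis mV : forall i, measurable_fun setT (V i).
Hypothesis lawV : forall i B, measurable B -> P (V i @^-1` B) = Q B.
Hypothesis indV : mutually_independent P (fun o : option nat =>
  if o is Some i then preimage_set_system setT (V i) measurable
  else process_sigma [set: nat] zeta).

Section product_functional.
Variable h : R * U -> R.
Hypothesis mh : measurable_fun setT h.
Hypothesis h01 : forall x, (0 <= h x <= 1)%R.

Let h0 x : (0 <= h x)%R. Proof. by case/andP: (h01 x). Qed.
Let h1 x : (h x <= 1)%R. Proof. by case/andP: (h01 x). Qed.

Let F (o : option nat) : set (set T) :=
  if o is Some i then preimage_set_system setT (V i) measurable
  else process_sigma [set: nat] zeta.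

Let mF o : F o `<=` measurable.
Proof.
case: o => [i _ [B mB <-]|]; first exact: mV.
apply: process_sigma_measurable; exact: (poisson_points pzeta).
Qed.

Let sF o : sigma_algebra setT (F o).
Proof.
case: o => [i|]; last exact: sigma_algebra_process_sigma.
by apply: sigma_algebra_preimage; exact: sigma_algebra_measurable.
Qed.

(** The average of [h] over the mark of a point located at [z]. *)
Let H z : R := fine (\int[Q]_v (h (z, v))%:E).

Let intH z : \int[Q]_v (h (z, v))%:E = (H z)%:E.
Proof.
rewrite /H fineK// ge0_fin_numE; last by apply: integral_ge0 => v _; rewrite lee_fin.
apply: (@le_lt_trans _ _ (\int[Q]_v 1)).
  apply: ge0_le_integral => //.
  - by move=> v _; rewrite lee_fin.
  - by apply/measurable_EFinP; exact: measurableT_comp.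
  - by move=> v _; rewrite lee_fin.
by rewrite integral_cst// mul1e (le_lt_trans (probability_le1 Q measurableT))// ltry.
Qed.

Let mH : measurable_fun setT H.
Proof.
apply/measurable_EFinP; rewrite (_ : EFin \o H = fubini_F Q (EFin \o h)).
  apply: measurable_fun_fubini_tonelli_F; first exact/measurable_EFinP.
  by move=> x; rewrite lee_fin.
by apply/funext => z; rewrite /fubini_F/= intH.
Qed.

Let H01 z : (0 <= H z <= 1)%R.
Proof.
rewrite -!lee_fin -intH integral_ge0//=; last by move=> v _; rewrite lee_fin.
rewrite -(probability_setT Q) -[leRHS]mul1e -integral_cst//.
apply: ge0_le_integral => //.
- by move=> v _; rewrite lee_fin.
- by apply/measurable_EFinP; exact: measurableT_comp.
- by move=> v _; rewrite lee_fin.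
Qed.

Let intV i z : \int[P]_w (h (z, V i w))%:E = (H z)%:E.
Proof.
rewrite -intH.
pose Vm : {mfun T >-> U} := HB.pack (V i) (isMeasurableFun.Build _ _ _ _ _ (mV i)).
transitivity (\int[distribution P Vm]_v (h (z, v))%:E).
  rewrite ge0_integral_distribution//.
    by apply/measurable_EFinP; exact: measurableT_comp.
  by move=> v; rewrite lee_fin.
by apply: eq_measure_integral => A mA _; exact: lawV.
Qed.

(** A hybrid product: the first [M] factors keep their marks, the others are already averaged. [M]
    goes from [N] down to 0 one mark at a time. *)
Let mixed N M w : R :=
  (\prod_(i < N) if (i < M)%N then h (zeta w i, V i w) else H (zeta w i))%R.

Let mixed_step N M : (M < N)%N ->
  \int[P]_w (mixed N M.+1 w)%:E = \int[P]_w (mixed N M w)%:E.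
Proof.
(* [J] gathers all of [zeta] and the marks of index below [M]. It determines every factor but the
   mark [V M], which is independent of it and can be integrated out. *)
move=> MN; pose J := (None |` [fset Some i | i in iota 0 M])%fset.
have iJ : Some M \notin J.
  rewrite /J !inE/=; apply/negP => /imfsetP[j /=].
  by rewrite mem_iota => /andP[_ +] [Mj]; rewrite -Mj add0n ltnn.
pose rest w : R := (\prod_(i < N | i != Ordinal MN)
  if (i < M)%N then h (zeta w i, V i w) else H (zeta w i))%R.
pose f (x : g_sigma_algebraType (joint_events F J) * U) : \bar R :=
  (rest x.1 * h (zeta x.1 M, x.2))%:E.
have rest0 w : (0 <= rest w)%R.
  apply: prodr_ge0 => i _; case: ifP => // _.
  by case/andP: (H01 (zeta w i)).
have mzJ i : measurable_fun setT
    ((fun w => zeta w i) : g_sigma_algebraType (joint_events F J) -> R).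
  apply: (measurable_joint_events (F := F) sF (j := None)); first by rewrite !inE.
  exact: preimage_process_sigma.
have mrest : measurable_fun setT
    (rest : g_sigma_algebraType (joint_events F J) -> R).
  rewrite /rest; under eq_fun do rewrite -big_filter.
  apply: measurable_prod => i _; case: ltnP => iM; last exact: measurableT_comp.
  apply: (measurableT_comp mh); apply: measurable_fun_pair => //.
  apply: (measurable_joint_events (F := F) sF (j := Some (i : nat))) => //.
  rewrite !inE/=; apply/imfsetP; exists (i : nat) => //=.
  by rewrite mem_iota add0n.
transitivity (\int[P]_w f (w, V M w)).
  apply: eq_integral => w _; rewrite /f /mixed /rest (bigD1 (Ordinal MN))//=.
  rewrite ltnSn mulrC; congr (_ * _)%:E; apply: eq_bigr => i iM.
  by rewrite ltnS leq_eqVlt (_ : (i == M :> nat) = false)//; apply: negbTE.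
rewrite (ge0_integral_independent_joint (F := F) mF sF indV iJ)//; last 2 first.
- apply/measurable_EFinP; apply: measurable_funM; first exact: measurableT_comp.
  apply: (measurableT_comp mh); apply: measurable_fun_pair => //.
  exact: (measurableT_comp (mzJ M)).
- by move=> x; rewrite lee_fin mulr_ge0.
apply: eq_integral => w _; rewrite /f /=.
under eq_integral do rewrite EFinM.
rewrite ge0_integralZl//.
- rewrite intV /mixed (bigD1 (Ordinal MN))//= ltnn -EFinM mulrC.
  by [].
- by apply/measurable_EFinP; apply: measurableT_comp => //; exact: measurableT_comp.
- by move=> ? _; rewrite lee_fin.
- by rewrite lee_fin.
Qed.

Let integral_mixed N :
  \int[P]_w (\prod_(i < N) h (zeta w i, V i w))%:E =
  \int[P]_w (\prod_(i < N) H (zeta w i))%:E.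
Proof.
have mixedE M : (M <= N)%N ->
    \int[P]_w (mixed N M w)%:E = \int[P]_w (mixed N 0 w)%:E.
  elim: M => // M IH MN; rewrite mixed_step// IH//; exact: ltnW.
transitivity (\int[P]_w (mixed N N w)%:E).
  by apply: eq_integral => w _; rewrite /mixed; under [in RHS]eq_bigr do rewrite ltn_ord.
by rewrite mixedE.
Qed.

Let intD : \int[nu]_(z in D) (1 - H z)%:E = \int[nu \x Q]_x (1 - h x)%:E.
Proof.
have intC z : \int[Q]_v (1 - h (z, v))%:E = (1 - H z)%:E.
  have mhz : measurable_fun setT (fun v => h (z, v)) by exact: measurableT_comp.
  have : \int[Q]_v (1 - h (z, v))%:E + \int[Q]_v (h (z, v))%:E = 1.
    rewrite -ge0_integralD//.
    - under eq_integral do rewrite -EFinD subrK.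
      by rewrite integral_cst// mul1e; exact: probability_setT.
    - by move=> v _; rewrite lee_fin subr_ge0.
    - by apply/measurable_EFinP; exact: measurable_funB.
    - by move=> v _; rewrite lee_fin.
    - exact/measurable_EFinP.
  by rewrite intH EFinB => <-; rewrite addeK.
rewrite fubini_tonelli1//; last 2 first.
- by apply/measurable_EFinP; exact: measurable_funB.
- by move=> x; rewrite lee_fin subr_ge0.
rewrite [RHS](@ge0_negligible_integral _ _ _ _ setT (~` D))//.
- rewrite setTD setCK; apply: eq_integral => z _; exact/esym/intC.
- exact: measurableC.
- apply: measurable_fun_fubini_tonelli_F.
    by apply/measurable_EFinP; exact: measurable_funB.
  by move=> x; rewrite lee_fin subr_ge0.
- by move=> z _; apply: integral_ge0 => v _; rewrite lee_fin subr_ge0.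
Qed.

Lemma cvg_integral_prod_marked :
  \int[P]_w (\prod_(i < N) h (zeta w i, V i w))%:E @[N --> \oo] -->
  expeR (- \int[nu \x Q]_x (1 - h x)%:E).
Proof.
under eq_cvg do rewrite integral_mixed.
by rewrite -intD; exact: (cvg_integral_prod_poisson mD pzeta nuE).
Qed.

End product_functional.

End marked_poisson_process.

Lemma lee_cvg (R : realType) (u v : nat -> \bar R) (a b : \bar R) :
  u n @[n --> \oo] --> a -> v n @[n --> \oo] --> b ->
  (forall n, u n <= v n) -> a <= b.
Proof.
move=> ua vb uv; rewrite -(cvg_lim _ ua)// -(cvg_lim _ vb)//.
apply: lee_lim; last exact: nearW.
- by apply/cvg_ex; exists a.
- by apply/cvg_ex; exists b.
Qed.

(** Comparison of the coefficients of [t] at 0: the derivative of [p * expR (t * a)] is [p * a], and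
    the error [t ^+ 2] is of higher order. Only [1 + x <= expR x] is used. *)
Lemma derivative_squeeze (R : realType) (a p q : R) : (0 <= a)%R -> (0 <= p)%R ->
  (0 <= q)%R ->
  (forall t, 0 < t < 1 -> p + t * q <= p * expR (t * a) <= p + t * q + t ^+ 2)%R ->
  q = (p * a)%R.
Proof.
move=> a0 p0 q0 bnd; apply/eqP; rewrite eq_le; apply/andP; split.
- apply/ler_addgt0Pr => e e0.
  (* The three terms ensure in turn [t < 1], [t * a <= 1] and [t * (a * q) <= e]; the added 1 keeps
     the denominators positive. *)
  pose t := (Num.min (2^-1) (Num.min ((a + 1)^-1) (e / (a * q + 1))))%R.
  have a1 : (0 < a + 1)%R by rewrite ltr_wpDl.
  have aq1 : (0 < a * q + 1)%R by rewrite ltr_wpDl// mulr_ge0.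
  have t0 : (0 < t)%R by rewrite /t !lt_min !invr_gt0 ltr0n a1 divr_gt0.
  have t1 : (t < 1)%R.
    by rewrite /t gt_min invf_lt1// ltr1n.
  have ta : (t * a <= 1)%R.
    apply: (@le_trans _ _ ((a + 1)^-1 * a)%R).
      by rewrite ler_wpM2r// /t !ge_min lexx !orbT.
    by rewrite mulrC ler_pdivrMr// mul1r lerDl.
  have te : (t * (a * q) <= e)%R.
    apply: (@le_trans _ _ (e / (a * q + 1) * (a * q))%R).
      by rewrite ler_wpM2r ?mulr_ge0// /t !ge_min lexx !orbT.
    by rewrite mulrAC ler_pdivrMr// ler_pM2l// lerDl.
  have /andP[+ _] := bnd t (introT andP (conj t0 t1)); move=> lb.
  (* From [1 - x <= expR (- x)]. Multiplying the lower bound by [1 - t * a] thus replaces the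
     exponential by a linear term. *)
  have ex : (expR (t * a) * (1 - t * a) <= 1)%R.
    rewrite -[leRHS](expR0 R) -(subrr (t * a)%R) expRD ler_wpM2l ?expR_ge0//.
    by have := expR_ge1Dx (- (t * a)).
  have : (t * q * (1 - t * a) <= p * (t * a))%R.
    apply: (@le_trans _ _ ((p * expR (t * a) - p) * (1 - t * a)))%R.
      by rewrite ler_wpM2r ?subr_ge0// lerBrDl.
    by have := ler_wpM2l p0 ex; nra.
  rewrite mulrBr mulr1 => H.
  have : (t * q <= t * (p * a) + t * (t * (a * q)))%R by nra.
  rewrite -mulrDr ler_pM2l// => /le_trans; apply.
  by rewrite lerD2l.
- apply/ler_addgt0Pr => e e0.
  pose t := Num.min (2^-1)%R e.
  have t0 : (0 < t)%R by rewrite /t lt_min invr_gt0 ltr0n.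
  have t1 : (t < 1)%R by rewrite /t gt_min invf_lt1// ltr1n.
  have te : (t <= e)%R by rewrite /t ge_min lexx orbT.
  have /andP[_ ub] := bnd t (introT andP (conj t0 t1)).
  apply: (@le_trans _ _ (q + t)%R); last by rewrite lerD2l.
  rewrite -(ler_pM2l t0).
  have := expR_ge1Dx (t * a); move=> /(ler_wpM2l p0) H.
  by nra.
Qed.

(** * Void and one-point probabilities *)

Section void_probability.
Context d (T : measurableType d) d' (W : measurableType d') (R : realType).
Variables (P : probability T R) (m : {measure set W -> \bar R}).
Variable phi : nat -> T -> W.
Hypothesis mphi : forall i, measurable_fun setT (phi i).
Hypothesis generating_functional : forall h : W -> R, measurable_fun setT h ->
  (forall x, 0 <= h x <= 1)%R ->
  \int[P]_w (\prod_(i < N) h (phi i w))%:E @[N --> \oo] -->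
  expeR (- \int[m]_x (1 - h x)%:E).

Let mpre i B : measurable B -> measurable (phi i @^-1` B).
Proof. by move=> mB; rewrite -[X in measurable X]setTI; exact: mphi. Qed.

Let all_first B N := [set w | forall i, (i < N)%N -> B (phi i w)].

Let measurable_all_first B N : measurable B -> measurable (all_first B N).
Proof.
move=> mB; rewrite (_ : all_first B N = \bigcap_(i in `I_N) phi i @^-1` B)//.
by apply: bigcap_measurableType => i _; exact: mpre.
Qed.

Lemma measurable_all_points B : measurable B ->
  measurable [set w | forall i, B (phi i w)].
Proof.
move=> mB; rewrite (_ : [set w | _] = \bigcap_i phi i @^-1` B).
  by apply: bigcap_measurableType => i _; exact: mpre.
by apply/seteqP; split => w /= h i; [move=> _; exact: h|exact: (h i I)].
Qed.

Let cvg_all_first B : measurable B ->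
  P (all_first B N) @[N --> \oo] --> P [set w | forall i, B (phi i w)].
Proof.
move=> mB; rewrite (_ : [set w | _] = \bigcap_N all_first B N); last first.
  apply/seteqP; split => w /= h; first by move=> N _ i _; exact: h.
  by move=> i; apply: (h i.+1 I) => //=.
apply: (@nonincreasing_cvg_mu _ _ _ P (all_first B)) => //.
- by rewrite (le_lt_trans (probability_le1 P _)) ?ltry//; exact: measurable_all_first.
- by move=> N; exact: measurable_all_first.
- by apply: bigcap_measurableType => N _; exact: measurable_all_first.
- move=> N N' NN'; apply/subsetPset => w h i iN; apply: h.
  exact: leq_trans NN'.
Qed.

Let prod_indic B N w : (\prod_(i < N) \1_B (phi i w))%R = \1_(all_first B N) w :> R.
Proof.
rewrite indicE; have [wB|wB] := pselect (all_first B N w).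
  by rewrite mem_set// big1// => i _; rewrite indicE mem_set//; exact: wB.
rewrite memNset//.
have /existsNP[i /not_implyP[iN Bi]] := wB.
by rewrite (bigD1 (Ordinal iN))//= indicE memNset// mul0r.
Qed.

Lemma void_probability B : measurable B ->
  P [set w | forall i, B (phi i w)] = expeR (- m (~` B)).
Proof.
move=> mB.
have mC : measurable (~` B) by exact: measurableC.
have -> : m (~` B) = \int[m]_x (1 - \1_B x)%:E.
  rewrite -[X in m X]setIT -integral_indic//; apply: eq_integral => x _.
  by rewrite !indicE in_setC; case: (x \in B); rewrite ?subrr ?subr0.
apply: (@cvg_unique _ (@ereal_hausdorff R) _ _ _ _ (cvg_all_first mB)).
have := @generating_functional (\1_B) (@measurable_indic _ _ R setT B mB).
under eq_cvg => N.
  rewrite (_ : \int[P]_w _ = P (all_first B N)); last first.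
    under eq_integral do rewrite prod_indic.
    by rewrite integral_indic ?setIT//; exact: measurable_all_first.
  over.
by apply => x; rewrite indicE; case: (_ \in _); rewrite lexx ler01.
Qed.

Section one_point.
Variables A B : set W.
Hypotheses (mA : measurable A) (mB : measurable B).
Hypothesis AB0 : A `&` B = set0.

Definition one_point_in := [set w | exists l, A (phi l w) /\
  forall i, i != l -> B (phi i w)].

Lemma measurable_one_point_in : measurable one_point_in.
Proof.
rewrite (_ : one_point_in = \bigcup_l (phi l @^-1` A `&`
  \bigcap_(i in [set i | i != l]) phi i @^-1` B)).
  apply: bigcupT_measurable => l; apply: measurableI; first exact: mpre.
  by apply: bigcap_measurableType => i _; exact: mpre.
apply/seteqP; split => w /= [l].
  by move=> [Al Bi]; exists l => //; split.
by move=> _ [Al Bi]; exists l; split.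
Qed.

Let AnB x : A x -> ~ B x.
Proof. by move=> Ax Bx; have : (A `&` B) x by []; rewrite AB0. Qed.

(** At most one of the first [N] points lies in [A], the rest in [B]. Unlike the event of exactly
    one such point, this one decreases in [N], so continuity from above applies. *)
Let few N := [set w | (forall i, (i < N)%N -> (A `|` B) (phi i w)) /\
  forall i j, (i < N)%N -> (j < N)%N -> i != j -> ~ (A (phi i w) /\ A (phi j w))].

Let measurable_few N : measurable (few N).
Proof.
rewrite (_ : few N = all_first (A `|` B) N `&`
  \bigcap_(i in `I_N) \bigcap_(j in `I_N `&` [set j | i != j])
    ~` (phi i @^-1` A `&` phi j @^-1` A)).
  apply: measurableI; first by apply: measurable_all_first; exact: measurableU.
  apply: bigcap_measurableType => i _; apply: bigcap_measurableType => j _.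
  by apply: measurableC; apply: measurableI; exact: mpre.
apply/seteqP; split => w /= [AuB h]; split => //.
  by move=> i iN j [jN ij]; exact: h.
by move=> i j iN jN ij; exact: (h i iN j).
Qed.

Let bigcap_few : \bigcap_N few N = [set w | forall i, B (phi i w)] `|` one_point_in.
Proof.
apply/seteqP; split => w /=.
  move=> h; have [[l Al]|/forallNP nA] := pselect (exists l, A (phi l w)).
    right; exists l; split => // i il.
    have [h1 h2] := h (maxn i l).+1 I.
    have [Ai|//] := h1 i (leq_maxl _ _ : (i < (maxn i l).+1)%N).
    by have [] := h2 i l (leq_maxl _ _ : (i < (maxn i l).+1)%N)
      (leq_maxr _ _ : (l < (maxn i l).+1)%N) il.
  left => i; have [h1 _] := h i.+1 I.
  by have [/nA|] := h1 i (ltnSn i).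
move=> [Bw|[l [Al Bw]]] N _; split.
- by move=> i _; right.
- by move=> i j _ _ _ [/AnB nB _]; apply: nB.
- by move=> i _; have [->|il] := eqVneq i l; [left|right; exact: Bw].
- move=> i j _ _ ij [Ai Aj].
  have [il|/Bw /(AnB Ai)//] := eqVneq i l.
  by have [jl|/Bw /(AnB Aj)//] := eqVneq j l; rewrite il jl eqxx in ij.
Qed.

Let cvg_few : P (few N) @[N --> \oo] -->
  P [set w | forall i, B (phi i w)] + P one_point_in.
Proof.
rewrite -measureU//.
- rewrite -bigcap_few; apply: (@nonincreasing_cvg_mu _ _ _ P few) => //.
  + by rewrite (le_lt_trans (probability_le1 P _)) ?ltry//; exact: measurable_few.
  + by apply: bigcap_measurableType => N _; exact: measurable_few.
  + move=> N N' NN'; apply/subsetPset => w [h1 h2]; split.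
      by move=> i iN; apply: h1; exact: leq_trans NN'.
    by move=> i j iN jN; apply: h2; exact: leq_trans NN'.
- exact: measurable_all_points.
- exact: measurable_one_point_in.
- by apply/seteqP; split => // w [Bw [l [/AnB nB _]]]; apply: nB.
Qed.

Let h (t : R) x : R := (\1_B x + t * \1_A x)%R.

Let hA t x : A x -> h t x = t.
Proof.
by move=> Ax; rewrite /h !indicE memNset ?mem_set ?mulr1 ?add0r//; exact: AnB.
Qed.

Let hB t x : B x -> h t x = 1%R.
Proof.
move=> Bx; rewrite /h !indicE mem_set// memNset ?mulr0 ?addr0//.
by move=> /AnB; apply.
Qed.

Let h01 t x : (0 < t < 1)%R -> (0 <= h t x <= 1)%R.
Proof.
move=> /andP[t0 t1]; have [Ax|nA] := pselect (A x).
  by rewrite hA// !ltW.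
have [Bx|nB] := pselect (B x); first by rewrite hB// ler01 lexx.
by rewrite /h !indicE !memNset// mulr0 addr0 lexx ler01.
Qed.

Let mh t : measurable_fun setT (h t).
Proof.
by apply: measurable_funD => //; apply: measurable_funM => //; exact: measurable_indic.
Qed.

(* Expanding the product of the [1_B + t 1_A] to first order in [t]. *)
Let prod_bound t N w : (0 < t < 1)%R ->
  ((1 - t) * \1_(all_first B N) w + t * \1_(few N) w <=
   \prod_(i < N) h t (phi i w) <=
   (1 - t) * \1_(all_first B N) w + t * \1_(few N) w + t ^+ 2)%R.
Proof.
move=> t01; have /andP[t0 t1] := t01.
have t2 : (0 <= t ^+ 2)%R by rewrite sqr_ge0.
have hge0 i : (0 <= h t (phi i w))%R by case/andP: (h01 (phi i w) t01).
rewrite !indicE.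
have [Bw|nBw] := pselect (all_first B N w).
  have fw : few N w.
    by split=> [i /Bw|i j /Bw Bi _ _ [/AnB nB _]]; [right|exact: nB].
  rewrite !mem_set// big1; last by move=> i _; rewrite hB//; exact: Bw.
  by rewrite !mulr1 subrK lexx lerDl.
rewrite (memNset nBw) mulr0 add0r.
have [[fw1 fw2]|nfw] := pselect (few N w).
  rewrite mem_set// mulr1.
  have /existsNP[l /not_implyP[lN nBl]] := nBw.
  have Al : A (phi l w) by have [] := fw1 l lN.
  rewrite (bigD1 (Ordinal lN))//= hA// big1 ?mulr1 ?lexx ?lerDl// => i il.
  have [Ai|Bi] := fw1 i (ltn_ord i); last exact: hB.
  by have [] := fw2 i l (ltn_ord i) lN.
rewrite (memNset nfw) mulr0 add0r; apply/andP; split.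
  by apply: prodr_ge0 => i _.
have [uw|nuw] := pselect (all_first (A `|` B) N w); last first.
  have /existsNP[l /not_implyP[lN /not_orP[nA nB]]] := nuw.
  by rewrite (bigD1 (Ordinal lN))//= /h !indicE !memNset// mulr0 addr0 mul0r.
have /existsNP[i /existsNP[j /not_implyP[iN /not_implyP[jN /not_implyP[ij]]]]] :
    ~ (forall i j, (i < N)%N -> (j < N)%N -> i != j ->
      ~ (A (phi i w) /\ A (phi j w))).
  by move=> h'; apply: nfw.
move=> /contrapT[Ai Aj].
(* Two points in [A] contribute [t * t] and the other factors are at most 1: this is the origin of
   the error term [t ^+ 2]. *)
rewrite (bigD1 (Ordinal iN))//= hA// (bigD1 (Ordinal jN))/=; last first.
  by apply: contra ij => /eqP [->].
rewrite hA// mulrA -expr2 ler_piMr//; apply: prodr_ile1 => k _.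
exact: h01.
Qed.

Lemma one_point_probability : P one_point_in = m A * expeR (- m (~` B)).
Proof.
have mC : measurable (~` B) by exact: measurableC.
rewrite -void_probability//.
set E0 := [set w | forall i, B (phi i w)].
have mE0 : measurable E0 by exact: measurable_all_points.
have mE1 := measurable_one_point_in.
pose p := fine (P E0); pose q := fine (P one_point_in).
have pE : P E0 = p%:E by rewrite fineK// fin_num_measure.
have qE : P one_point_in = q%:E by rewrite fineK// fin_num_measure.
have p0 : (0 <= p)%R by exact: fine_ge0.
have q0 : (0 <= q)%R by exact: fine_ge0.
pose J t := \int[m]_x (1 - h t x)%:E.
have bnd t : (0 < t < 1)%R ->
    (p + t * q)%:E <= expeR (- J t) <= (p + t * q + t ^+ 2)%:E.
  move=> t01; have /andP[t0 t1] := t01.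
  have t1' : (0 <= 1 - t)%R by rewrite subr_ge0 ltW.
  have lowE N : \int[P]_w ((1 - t) * \1_(all_first B N) w + t * \1_(few N) w)%:E =
      (1 - t)%:E * P (all_first B N) + t%:E * P (few N).
    have mi := @measurable_all_first B N mB.
    have mf := measurable_few N.
    under eq_integral do rewrite EFinD !EFinM.
    rewrite ge0_integralD//.
    - rewrite !ge0_integralZl//.
      + by rewrite !integral_indic// !setIT.
      + by apply/measurable_EFinP; exact: measurable_indic.
      + by rewrite lee_fin ltW.
      + by apply/measurable_EFinP; exact: measurable_indic.
    - by move=> w _; rewrite mule_ge0// lee_fin.
    - apply/measurable_EFinP; apply: measurable_funM => //.
    - by move=> w _; rewrite mule_ge0// lee_fin// ltW.
    - apply/measurable_EFinP; apply: measurable_funM => //.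
  have cvg_low : (1 - t)%:E * P (all_first B N) + t%:E * P (few N)
      @[N --> \oo] --> (p + t * q)%:E.
    (* The events [few N] decrease to the union of [E0] and [one_point_in], of probability
       [p + q]. *)
    rewrite (_ : (p + t * q)%:E = (1 - t)%:E * P E0 + t%:E * (P E0 + P one_point_in)); last first.
      by rewrite pE qE -(EFinD p q) -!EFinM -EFinD; congr EFin; ring.
    apply: cvgeD.
    + by rewrite pE qE -(EFinD p q) -!EFinM.
    + by apply: cvgeZl => //; exact: cvg_all_first.
    + by apply: cvgeZl => //; exact: cvg_few.
  have mprod N : measurable_fun setT (fun w => (\prod_(i < N) h t (phi i w))%R).
    by apply: measurable_prod => i _; apply: (measurableT_comp (mh t)).
  have mlow N : measurable_fun setT
      (fun w => ((1 - t) * \1_(all_first B N) w + t * \1_(few N) w)%R).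
    apply: measurable_funD; apply: measurable_funM => //; apply: measurable_indic.
    exact: measurable_all_first.
  have low0 N w : (0 <= (1 - t) * \1_(all_first B N) w + t * \1_(few N) w)%R.
    by rewrite addr_ge0// mulr_ge0// ltW.
  have prod0 N w : (0 <= \prod_(i < N) h t (phi i w))%R.
    by apply: prodr_ge0 => i _; case/andP: (h01 (phi i w) t01).
  have gf := generating_functional (mh t) (fun x => h01 x t01).
  apply/andP; split.
    apply: (lee_cvg cvg_low gf) => N; rewrite -lowE.
    apply: ge0_le_integral => //.
    - by move=> w _; rewrite lee_fin.
    - exact/measurable_EFinP.
    - exact/measurable_EFinP.
    - by move=> w _; rewrite lee_fin; case/andP: (prod_bound N w t01).
  rewrite EFinD.
  have cvg_up : (1 - t)%:E * P (all_first B N) + t%:E * P (few N) + (t ^+ 2)%:E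
      @[N --> \oo] --> (p + t * q)%:E + (t ^+ 2)%:E.
    apply: cvgeD => //; exact: cvg_cst.
  apply: (lee_cvg gf cvg_up) => N; rewrite -lowE.
  rewrite [leRHS](_ : _ = \int[P]_w ((1 - t) * \1_(all_first B N) w +
      t * \1_(few N) w + t ^+ 2)%:E); last first.
    under [RHS]eq_integral do rewrite EFinD.
    rewrite ge0_integralD//.
    - congr (_ + _); rewrite integral_cst//.
      by rewrite [X in _ * X](_ : _ = 1) ?mule1//; exact: probability_setT.
    - by move=> w _; rewrite lee_fin.
    - exact/measurable_EFinP.
    - by move=> w _; rewrite lee_fin sqr_ge0.
  apply: ge0_le_integral => //.
  - by move=> w _; rewrite lee_fin.
  - exact/measurable_EFinP.
  - by apply/measurable_EFinP; apply: measurable_funD.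
  - by move=> w _; rewrite lee_fin; case/andP: (prod_bound N w t01).
have JE t : (0 < t < 1)%R -> J t + t%:E * m A = m (~` B).
  move=> t01; have /andP[t0 t1] := t01.
  rewrite -[X in _ * m X](setIT A) -integral_indic// -ge0_integralZl//; last 2 first.
  - by apply/measurable_EFinP; exact: measurable_indic.
  - by rewrite lee_fin ltW.
  rewrite -ge0_integralD//; last 4 first.
  - by move=> x _; rewrite lee_fin subr_ge0; case/andP: (h01 x t01).
  - by apply/measurable_EFinP; exact: measurable_funB.
  - by move=> x _; rewrite mule_ge0 ?lee_fin// ltW.
  - by apply: measurable_funeM; apply/measurable_EFinP; exact: measurable_indic.
  rewrite -[X in _ = m X](setIT (~` B)) -integral_indic//; apply: eq_integral => x _.
  rewrite -EFinM -EFinD; congr EFin.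
  by rewrite /h !indicE in_setC; case: (x \in B) => /=; ring.
have [mBy|] := ltP (m (~` B)) +oo; last first.
  rewrite leye_eq => /eqP mBy.
  have half : (0 < (2^-1 : R) < 1)%R by rewrite invr_gt0 ltr0n invf_lt1// ltr1n.
  have : (2^-1)%:E * m (~` B) <= J (2^-1)%R.
    rewrite -[X in m X](setIT (~` B)) -integral_indic// -ge0_integralZl//; last first.
      by apply/measurable_EFinP; exact: measurable_indic.
    apply: ge0_le_integral => //.
    - by apply: measurable_funeM; apply/measurable_EFinP; exact: measurable_indic.
    - by apply/measurable_EFinP; exact: measurable_funB.
    - move=> x _; rewrite -EFinM lee_fin.
      have [Bx|nB] := pselect (B x).
        by rewrite hB// indicE in_setC mem_set// mulr0 subrr.
      have [Ax|nA] := pselect (A x).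
        by rewrite hA// indicE in_setC memNset// mulr1; lra.
      by rewrite /h !indicE in_setC !memNset//=; lra.
  rewrite mBy gt0_muley ?lte_fin ?invr_gt0// leye_eq => /eqP Jy.
  have := bnd _ half; rewrite Jy/= => /andP[+ _].
  rewrite lee_fin => pq0.
  have q00 : q = 0%R by lra.
  have p00 : p = 0%R by lra.
  by rewrite pE qE q00 p00 mule0.
have bfin : m (~` B) \is a fin_num by rewrite ge0_fin_numE.
have afin : m A \is a fin_num.
  rewrite ge0_fin_numE// (le_lt_trans _ mBy)// le_measure ?inE//.
have pb : p = expR (- fine (m (~` B))).
  have := void_probability mB; rewrite -/E0 pE -{1}(fineK bfin) /=.
  by move=> [].
rewrite pE qE -(fineK afin) -EFinM; congr EFin; rewrite mulrC.
apply: derivative_squeeze => // t t01.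
have Jt : J t = (fine (m (~` B)) - t * fine (m A))%:E.
  rewrite EFinB fineK// EFinM fineK// -(JE t t01) addeK//.
  by rewrite fin_numM.
have pE' : expR (- (fine (m (~` B)) - t * fine (m A))) =
    (p * expR (t * fine (m A)))%R.
  by rewrite opprB expRD -pb mulrC.
by have := bnd _ t01; rewrite Jt /= !lee_fin pE'.
Qed.

End one_point.

End void_probability.

(** * The intensity measure *)

Section inv_sq.
Variable R : realType.

(** Intersecting with the positive half-line gives a measure on all of [R], carried by that
    half-line and equal to [inv_sq_measure] on its subsets. *)
Definition inv_sq (B : set R) : \bar R :=
  inv_sq_measure (B `&` [set z | (0 < z)%R]).

Let D : set R := [set z | (0 < z)%R].

Let DE : D = `]0%R, +oo[%classic.
Proof. by apply/seteqP; split => z /=; rewrite in_itv/= andbT. Qed.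

Let mD : measurable D. Proof. by rewrite DE. Qed.

Let f0 z : 0 <= (z ^- 2)%:E :> \bar R.
Proof. by rewrite lee_fin invr_ge0 sqr_ge0. Qed.

Let continuous_f z : (0 < z)%R -> {for z, continuous (fun z : R => z ^- 2)%R}.
Proof.
move=> z0; apply: cvgV; first by rewrite expf_neq0// gt_eqF.
exact: exprn_continuous.
Qed.

Let mf : measurable_fun D (fun z : R => (z ^- 2)%:E).
Proof.
apply/measurable_EFinP; rewrite DE; apply: open_continuous_measurable_fun => //.
by move=> z; rewrite inE/= in_itv/= andbT => z0; exact: continuous_f.
Qed.

Let inv_sq0 : inv_sq set0 = 0.
Proof. by rewrite /inv_sq /inv_sq_measure set0I integral_set0. Qed.

Let inv_sq_ge0 B : 0 <= inv_sq B.
Proof. by apply: integral_ge0. Qed.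

Let inv_sq_sigma_additive : semi_sigma_additive inv_sq.
Proof.
move=> F mF tF mUF; rewrite /inv_sq /inv_sq_measure setI_bigcupl.
rewrite ge0_integral_bigcup//=.
- by apply: is_cvg_nneseries => n _ _; exact: integral_ge0.
- by move=> k; exact: (measurableI _ _ (mF k) mD).
- rewrite -setI_bigcupl; apply: measurable_funS mf => //.
- exact: trivIset_setIr.
Qed.

HB.instance Definition _ := isMeasure.Build _ _ _ inv_sq
  inv_sq0 inv_sq_ge0 inv_sq_sigma_additive.

Lemma inv_sq_subE B : B `<=` [set z | (0 < z)%R] -> inv_sq_measure B = inv_sq B.
Proof. by move=> BD; rewrite /inv_sq setIidl. Qed.

Lemma inv_sq_setC : inv_sq (~` [set z | (0 < z)%R]) = 0.
Proof. by rewrite /inv_sq /inv_sq_measure setICl integral_set0. Qed.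

Lemma inv_sq_itv_infty (a : R) : (0 < a)%R -> inv_sq `]a, +oo[ = (a^-1)%:E.
Proof.
move=> a0; rewrite /inv_sq setIidl; last first.
  by move=> z /=; rewrite in_itv/= andbT; exact: lt_trans.
rewrite /inv_sq_measure integral_itv_obnd_cbnd; last first.
  apply: measurable_funS mf => //.
  by move=> z /=; rewrite in_itv/= andbT; exact: lt_trans.
have cV (z : R) : (0 < z)%R -> {for z, continuous (fun z : R => - z^-1)%R}.
  by move=> z0; apply: cvgN; apply: cvgV; rewrite ?gt_eqF.
have dV (z : R) : (0 < z)%R -> is_derive z 1%R (fun z : R => - z^-1)%R (z ^- 2).
  move=> z0; have z0' : z != 0%R by rewrite gt_eqF.
  have dinv : is_derive z 1%R (fun y : R => y^-1)%R (- z ^- 2 *: 1)%R.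
    exact: is_deriveV.
  apply: is_derive_eq.
  by rewrite scaleNr opprK [LHS]mulr1.
rewrite (@ge0_continuous_FTC2y _ _ (fun z => - z^-1)%R _ 0).
- by rewrite EFinN oppeK add0e.
- by move=> z az; rewrite -lee_fin.
- apply/continuous_within_itvcyP; split.
    move=> z; rewrite in_itv/= andbT => az; apply: continuous_f.
    exact: lt_trans az.
  by apply: cvg_at_right_filter; exact: continuous_f.
- rewrite -oppr0; apply: cvgN; apply/(gtr0_cvgV0 (f := fun z : R => z)); last exact: cvg_id.
  exact: nbhs_pinfty_gt.
- by move=> z az; have [] := dV z (lt_trans a0 az).
- by apply: cvg_at_right_filter; exact: cV.
- move=> z; rewrite in_itv/= andbT => az; rewrite derive1E.
  by have [_] := dV z (lt_trans a0 az).
Qed.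

Let inv_sq_sigma_finite : sigma_finite setT inv_sq.
Proof.
(* Each half-line has mass [n + 1], and the complement of [D], added so as to cover all of [R], is
   null. *)
exists (fun n => `]n.+1%:R^-1%R, +oo[%classic `|` ~` D).
  apply/seteqP; split => // z _; have [z0|z0] := ltP 0%R z; last first.
    by exists 0%N => //; right => /=; apply/negP; rewrite -leNgt.
  exists (Num.truncn (z^-1)) => //; left => /=; rewrite in_itv/= andbT.
  by rewrite -[ltRHS]invrK ltf_pV2 ?posrE ?invr_gt0// truncnS_gt.
move=> n; split; first by apply: measurableU => //; exact: measurableC.
apply: (@le_lt_trans _ _ (inv_sq `]n.+1%:R^-1%R, +oo[ + inv_sq (~` D))).
  by apply: measureU2 => //; exact: measurableC.
by rewrite inv_sq_setC adde0 inv_sq_itv_infty ?invr_gt0// ltry.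
Qed.

HB.instance Definition _ := Measure_isSigmaFinite.Build _ _ _ inv_sq
  inv_sq_sigma_finite.

End inv_sq.

Section sigma_finite_product.
Context d1 d2 (T1 : measurableType d1) (T2 : measurableType d2) (R : realType).
Variables (m : {sigma_finite_measure set T1 -> \bar R}) (Q : probability T2 R).

(* An alias of [m \x Q]: the canonical sigma-finite measure attached to the
   constant [product_measure1] is that of a product of probabilities. *)
Definition sigma_finite_product : set (T1 * T2) -> \bar R := m \x Q.

HB.instance Definition _ := Measure.on sigma_finite_product.

Let sigma_finite_productT : sigma_finite setT sigma_finite_product.
Proof.
have [F F_cover F_fin] := sigma_finiteT m.
exists (fun n => F n `*` setT).
  by rewrite -setX_bigcupl -F_cover setXTT.
move=> n; have [mF Foo] := F_fin n; split; first exact: measurableX.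
rewrite /sigma_finite_product product_measure1E// [X in _ * X](_ : _ = 1) ?mule1//.
exact: probability_setT.
Qed.

HB.instance Definition _ := Measure_isSigmaFinite.Build _ _ _
  sigma_finite_product sigma_finite_productT.

End sigma_finite_product.

(** * Strict domination *)

Section dyadic_cell.
Variable R : realType.
Implicit Types (x y : R) (Y : R -> Prop).

(** Open on the left, so that a bound by the left end point is strictly below [x]. As [p] is a
    natural number, only positive [x] have a cell. *)
Definition dyadic_cell n (p : nat) x : Prop :=
  (p%:R / 2 ^+ n < x <= p.+1%:R / 2 ^+ n)%R.

(* When [Y] is the set of upper bounds of some family, [dyadic_gap n Y x] says
   that the left end point of the dyadic cell of rank [n] of [x] bounds the
   family. *)
Definition dyadic_gap n Y x : Prop :=
  exists2 p : nat, dyadic_cell n p x & Y (p%:R / 2 ^+ n)%R.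

Let exp2_gt0 n : (0 < 2 ^+ n :> R)%R. Proof. by rewrite exprn_gt0. Qed.

Lemma dyadic_cell_inj n p q x : dyadic_cell n p x -> dyadic_cell n q x -> p = q.
Proof.
move=> /andP[px xp] /andP[qx xq]; apply/eqP; rewrite eqn_leq -(ltnS p) -(ltnS q).
rewrite -(ltr_nat R p) -(ltr_nat R q).
rewrite -(ltr_pM2r (x := (2 ^+ n)^-1)%R) ?invr_gt0// (lt_le_trans px xq).
by rewrite -(ltr_pM2r (x := (2 ^+ n)^-1)%R) ?invr_gt0// (lt_le_trans qx xp).
Qed.

(** Halving the cell keeps its left end point or moves it to the midpoint, and an upper bound stays
    one when increased. *)
Lemma dyadic_gapS n Y x : (forall a b, (a <= b)%R -> Y a -> Y b) ->
  dyadic_gap n Y x -> dyadic_gap n.+1 Y x.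
Proof.
move=> mono [p /andP[px xp] Yp].
have e0 (q : nat) : ((2 * q)%:R / 2 ^+ n.+1 = q%:R / 2 ^+ n :> R)%R.
  by rewrite natrM exprS -mulf_div divff// mul1r.
have [xle|xgt] := leP x ((2 * p).+1%:R / 2 ^+ n.+1)%R.
  exists (2 * p)%N; last by rewrite e0.
  by rewrite /dyadic_cell e0 px xle.
exists (2 * p).+1.
  by rewrite /dyadic_cell xgt/= -[(2 * p).+2]/(2 + 2 * p)%N -mulnS e0.
apply: mono Yp; rewrite -e0 ler_pM2r ?invr_gt0// ler_nat.
exact: leqnSn.
Qed.

Lemma dyadic_gap_homo Y x : (forall a b, (a <= b)%R -> Y a -> Y b) ->
  forall m n, (m <= n)%N -> dyadic_gap m Y x -> dyadic_gap n Y x.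
Proof.
move=> mono m n /subnKC <-; elim: (n - m)%N => [|q IH]; first by rewrite addn0.
by move=> /IH; rewrite addnS; exact: dyadic_gapS.
Qed.

Lemma ex_dyadic_cell n x : (0 < x)%R -> exists p, dyadic_cell n p x.
Proof.
move=> x0.
have ex : exists q, (2 ^+ n * x <= q.+1%:R)%R.
  by exists (Num.truncn (2 ^+ n * x)); exact/ltW/truncnS_gt.
case: (ex_minnP ex) => p xp pmin; exists p; apply/andP; split; last first.
  by rewrite ler_pdivlMr// mulrC.
rewrite ltr_pdivrMr// mulrC; case: p pmin {xp} => [_|p pmin]; first exact: mulr_gt0.
by rewrite ltNge; apply/negP => /pmin; rewrite ltnn.
Qed.

Lemma ex_dyadic_gap Y x : (forall a b, (a <= b)%R -> Y a -> Y b) ->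
  (exists2 a, (a < x)%R & Y a) -> (0 < x)%R -> exists n, dyadic_gap n Y x.
Proof.
move=> mono [a ax Ya] x0.
(* Chosen so that the cells are shorter than [x - a]; the left end point of the cell of [x] then
   lies above [a]. *)
pose n := Num.truncn ((x - a)^-1).
have n2 : ((2 ^+ n)^-1 < x - a)%R.
  rewrite -[ltRHS]invrK ltf_pV2 ?posrE ?invr_gt0 ?subr_gt0//.
  by apply: (lt_le_trans (truncnS_gt _)); rewrite -natrX ler_nat ltn_expl.
have [p xp] := ex_dyadic_cell n x0; exists n; exists p => //.
apply: mono Ya; move/andP: xp => [_]; rewrite -natr1 mulrDl mul1r.
by move: n2; set e := (2 ^+ n)^-1%R; lra.
Qed.

End dyadic_cell.

Section strict_domination.
Context d (T : measurableType d) d' (W : measurableType d') (R : realType).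
Variables (P : probability T R) (m : {sigma_finite_measure set W -> \bar R}).
Variable phi : nat -> T -> W.
Hypothesis mphi : forall i, measurable_fun setT (phi i).
Hypothesis generating_functional : forall h : W -> R, measurable_fun setT h ->
  (forall x, 0 <= h x <= 1)%R ->
  \int[P]_w (\prod_(i < N) h (phi i w))%:E @[N --> \oo] -->
  expeR (- \int[m]_x (1 - h x)%:E).
Variables (K : finType) (i0 : K) (x : K -> W -> R) (eta : K -> T -> \bar R).
Hypothesis mx : forall j, measurable_fun setT (x j).
Hypothesis meta : forall j, measurable_fun setT (eta j).
(** The only link between [eta] and the points: [eta] has the law of their maximum at the sites. It
    will be applied to the independent copy. *)
Hypothesis eta_law : forall a : K -> R,
  P [set w | forall j, eta j w <= (a j)%:E] =
  P [set w | forall i j, (x j (phi i w) <= a j)%R].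

Definition strict_gap n l j w :=
  dyadic_gap n (fun a => forall i, i != l -> (x j (phi i w) <= a)%R) (x j (phi l w)).

Definition strictly_dominated n := [set w | exists l, forall j, strict_gap n l j w].

(** The counterpart of [strictly_dominated], with the competing points replaced by an independent
    maximum and the winning point drawn from [m]. *)
Let gap n : set (T * W) :=
  [set z | forall j, dyadic_gap n (fun a => eta j z.1 <= a%:E) (x j z.2)].

Let A n (f : {ffun K -> nat}) := [set v | forall j, dyadic_cell n (f j) (x j v)].
Let B n (f : {ffun K -> nat}) :=
  [set v | forall j, (x j v <= (f j)%:R / 2 ^+ n)%R].
Let E n (f : {ffun K -> nat}) :=
  [set w | forall j, eta j w <= ((f j)%:R / 2 ^+ n)%:E].

Let mA n f : measurable (A n f).
Proof.
rewrite (_ : A n f = \bigcap_(j in [set: K])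
    x j @^-1` `]((f j)%:R / 2 ^+ n)%R, ((f j).+1%:R / 2 ^+ n)%R]%classic); last first.
  apply/seteqP; split => v h j; first by move=> _; rewrite /= in_itv/=; exact: h.
  by have := h j I; rewrite /= in_itv.
apply: fin_bigcap_measurable => [|j _]; first exact: finite_finset.
by rewrite -[X in measurable X]setTI; exact: mx.
Qed.

Let mB n f : measurable (B n f).
Proof.
rewrite (_ : B n f = \bigcap_(j in [set: K])
    x j @^-1` `]-oo, ((f j)%:R / 2 ^+ n)%R]%classic); last first.
  apply/seteqP; split => v h j; first by move=> _; rewrite /= in_itv/=; exact: h.
  by have := h j I; rewrite /= in_itv.
apply: fin_bigcap_measurable => [|j _]; first exact: finite_finset.
by rewrite -[X in measurable X]setTI; exact: mx.
Qed.

Let mE n f : measurable (E n f).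
Proof.
rewrite (_ : E n f = \bigcap_(j in [set: K])
    eta j @^-1` `]-oo, ((f j)%:R / 2 ^+ n)%:E]%classic); last first.
  apply/seteqP; split => v h j; first by move=> _; rewrite /= in_itv/=; exact: h.
  by have := h j I; rewrite /= in_itv.
apply: fin_bigcap_measurable => [|j _]; first exact: finite_finset.
by rewrite -[X in measurable X]setTI; apply: meta => //; exact: emeasurable_itv.
Qed.

Let AB0 n f : A n f `&` B n f = set0.
Proof.
apply/seteqP; split => // v [/(_ i0) /andP[+ _] /(_ i0)].
by rewrite ltNge => /negP.
Qed.

Let finite_choice (S : K -> nat -> Prop) : (forall j, exists p, S j p) ->
  exists f : {ffun K -> nat}, forall j, S j (f j).
Proof. by move=> /choice[f fS]; exists (finfun f) => j; rewrite ffunE. Qed.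

Let dominatedE n : strictly_dominated n =
  \bigcup_(f in [set: {ffun K -> nat}]) one_point_in phi (A n f) (B n f).
Proof.
apply/seteqP; split => w.
  move=> [l h]; have [|f fS] := finite_choice (S := fun j p =>
      dyadic_cell n p (x j (phi l w)) /\
      forall i, i != l -> (x j (phi i w) <= p%:R / 2 ^+ n)%R).
    by move=> j; have [p ? ?] := h j; exists p.
  exists f => //; exists l; split => [j|i il j]; first by case: (fS j).
  by case: (fS j) => _; exact.
move=> [f _ [l [Al Bi]]]; exists l => j; exists (f j); first exact: Al.
by move=> i il; exact: Bi.
Qed.

Let gapE n : gap n = \bigcup_(f in [set: {ffun K -> nat}]) (E n f `*` A n f).
Proof.
apply/seteqP; split => -[w v].
  move=> h; have [|f fS] := finite_choice (S := fun j p =>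
      dyadic_cell n p (x j v) /\ eta j w <= (p%:R / 2 ^+ n)%:E).
    by move=> j; have [p ? ?] := h j; exists p.
  by exists f => //; split => j; case: (fS j).
by move=> [f _ [Ew Av]] j; exists (f j); [exact: Av|exact: Ew].
Qed.

(* Enumerates the cells along [nat]; the indices that are not codes
   contribute the empty set. *)
Let enum_cells S (F : {ffun K -> nat} -> set S) q : set S :=
  if @pickle_inv {ffun K -> nat} q is Some f then F f else set0.

Let bigcup_enum_cells S (F : {ffun K -> nat} -> set S) :
  \bigcup_(f in [set: {ffun K -> nat}]) F f = \bigcup_q enum_cells F q.
Proof.
rewrite /enum_cells; apply/seteqP; split => y.
  by move=> [f _ Ff]; exists (choice.pickle f) => //; rewrite pickleK_inv.
by move=> [q _]; case: pickle_inv => // f Ff; exists f.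
Qed.

Let trivIset_enum_cells S (F : {ffun K -> nat} -> set S) :
  (forall f g y, F f y -> F g y -> f = g) -> trivIset setT (enum_cells F).
Proof.
move=> Finj p q _ _ [y []]; rewrite /enum_cells.
have := @pickle_invK {ffun K -> nat} p; have := @pickle_invK {ffun K -> nat} q.
case: pickle_inv => //= f fq; case: pickle_inv => //= g gp Fg Ff.
by rewrite -fq -gp (Finj _ _ _ Fg Ff).
Qed.

Let A_inj n f g v : A n f v -> A n g v -> f = g.
Proof.
by move=> Af Ag; apply/ffunP => j; apply: dyadic_cell_inj (Af j) (Ag j).
Qed.

(** Two distinct winners would each lie strictly above the other at the site [i0]. With a single
    winner, its cell determines [f]. *)
Let one_point_inj n f g w : one_point_in phi (A n f) (B n f) w ->
  one_point_in phi (A n g) (B n g) w -> f = g.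
Proof.
move=> [l [Al Bl]] [l' [Al' Bl']].
have [ll'|ll'] := eqVneq l l'; first by apply: A_inj Al _; rewrite ll'.
have Bgl := Bl' l ll'; rewrite eq_sym in ll'; have Bfl' := Bl l' ll'.
have /andP[h1 _] := Al i0; have /andP[h2 _] := Al' i0.
have := lt_le_trans h1 (le_trans (Bgl i0) (ltW (lt_le_trans h2 (Bfl' i0)))).
by rewrite ltxx.
Qed.

Let prob_dominated n : P (strictly_dominated n) = (P \x m) (gap n).
Proof.
rewrite dominatedE gapE !bigcup_enum_cells.
have mF q : measurable (enum_cells (fun f => one_point_in phi (A n f) (B n f)) q).
  by rewrite /enum_cells; case: pickle_inv => // f; exact: measurable_one_point_in.
have mG q : measurable (enum_cells (fun f => E n f `*` A n f) q).
  by rewrite /enum_cells; case: pickle_inv => // f; exact: measurableX.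
rewrite !measure_bigcup//; last 2 first.
- by apply: trivIset_enum_cells => f g [w v] [_ Af] [_ Ag]; exact: A_inj Af Ag.
- by apply: trivIset_enum_cells => f g w; exact: one_point_inj.
apply: eq_eseriesr => q _; rewrite /enum_cells; case: pickle_inv => [f|]; last first.
  by rewrite !measure0.
have h1 := one_point_probability mphi generating_functional (@mA n f) (@mB n f) (@AB0 n f).
have h2 := void_probability mphi generating_functional (@mB n f).
have h3 := product_measure1E P m (@mE n f) (@mA n f).
have h4 : P (E n f) = P [set w | forall i, B n f (phi i w)] := eta_law _.
transitivity (P (E n f) * m (A n f)); last exact/esym/h3.
by rewrite h4 h2 muleC; exact: h1.
Qed.

Let mono_bound l j w a b : (a <= b)%R ->
  (forall i, i != l -> (x j (phi i w) <= a)%R) ->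
  (forall i, i != l -> (x j (phi i w) <= b)%R).
Proof. by move=> ab h i /h ia; exact: le_trans ab. Qed.

Let mono_eta j w a b : (a <= b)%R -> eta j w <= a%:E -> eta j w <= b%:E.
Proof. by move=> ab /le_trans; apply; rewrite lee_fin. Qed.

Lemma measurable_strictly_dominated n : measurable (strictly_dominated n).
Proof.
rewrite dominatedE bigcup_enum_cells; apply: bigcupT_measurable => q.
by rewrite /enum_cells; case: pickle_inv => // f; exact: measurable_one_point_in.
Qed.

Lemma strict_gap_homo l j w n n' : (n <= n')%N ->
  strict_gap n l j w -> strict_gap n' l j w.
Proof. by move=> nn'; apply: dyadic_gap_homo nn'; exact: mono_bound. Qed.

Theorem strict_domination_probability :
  P (\bigcup_n strictly_dominated n) =
  (P \x m) [set z | forall j, eta j z.1 < (x j z.2)%:E /\ (0 < x j z.2)%R].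
Proof.
have mgap n : measurable (gap n).
  rewrite gapE bigcup_enum_cells; apply: bigcupT_measurable => q.
  by rewrite /enum_cells; case: pickle_inv => // f; exact: measurableX.
rewrite (_ : [set z | _] = \bigcup_n gap n); last first.
  apply/seteqP; split => -[w v] /=.
    move=> h.
    have /choice[N hN] : forall j, exists n,
        dyadic_gap n (fun a => eta j w <= a%:E) (x j v).
      move=> j; have [ex x0] := h j; apply: ex_dyadic_gap x0; first exact: mono_eta.
      case: (eta j w) ex => [r|//|_]; first by rewrite lte_fin; exists r.
      by exists (x j v - 1)%R; rewrite ?gtrBl// leNye.
    (* Gaps persist under refinement, so the largest of the finitely many ranks serves all sites. *)
    exists (\max_j N j) => // j; apply: dyadic_gap_homo (hN j) => //.
      exact: mono_eta.
    exact: leq_bigmax.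
  move=> [n _ h] j; have [p /andP[px _] ep] := h j; split.
    by rewrite (le_lt_trans ep)// lte_fin.
  by apply: le_lt_trans px; rewrite divr_ge0// exprn_ge0.
have c1 : P (strictly_dominated n) @[n --> \oo] --> P (\bigcup_n strictly_dominated n).
  apply: nondecreasing_cvg_mu.
  - exact: measurable_strictly_dominated.
  - by apply: bigcupT_measurable; exact: measurable_strictly_dominated.
  - move=> n n' nn'; apply/subsetPset => w [l h]; exists l => j.
    exact: strict_gap_homo (h j).
have c2 : (P \x m) (gap n) @[n --> \oo] --> (P \x m) (\bigcup_n gap n).
  apply: nondecreasing_cvg_mu => //.
  - exact: bigcupT_measurable.
  - move=> n n' nn'; apply/subsetPset => -[w v] h j.
    by apply: dyadic_gap_homo (h j) => //; exact: mono_eta.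
apply: (cvg_unique _ c1) => //; move: c2; apply: cvg_trans.
by apply: near_eq_cvg; apply: nearW => n; exact/esym/prob_dominated.
Qed.

End strict_domination.

(** * Inclusion-exclusion and the Frechet law *)

Section inclusion_exclusion.
Context d (T : measurableType d) (R : realType).
Variables (m : {measure set T -> \bar R}) (k : nat) (D : 'I_k -> set T).
Hypothesis k0 : (0 < k)%N.
Hypothesis mD : forall j, measurable (D j).
Hypothesis finD : forall j, m (D j) < +oo.

Let union (J : {set 'I_k}) := \bigcup_(j in [set` J]) D j.

(** Each factor is written [1 - (1 - \1_(D j) x)] and the product expanded over subsets [J]; the
    product of the [1 - \1_(D j) x] over [J] is [1 - \1_(union J) x]. The constants cancel because
    the sum of [(-1) ^+ #|J|] is [(1 - 1) ^+ k], which is 0 for [k > 0]. *)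
Let prod_indic_inclusion_exclusion x :
  (\prod_(j < k) \1_(D j) x =
   \sum_(J : {set 'I_k}) - (-1) ^+ #|J| * \1_(union J) x :> R)%R.
Proof.
have expand (b : 'I_k -> R) : (\prod_(j < k) (1 - b j) =
    \sum_(J : {set 'I_k}) (-1) ^+ #|J| * \prod_(j in J) b j)%R.
  under eq_bigr do rewrite addrC.
  rewrite bigA_distr; apply: eq_bigr => J _.
  rewrite (bigID (mem J))/= [X in (_ * X)%R]big1 ?mulr1; last first.
    by move=> j /negbTE ->.
  under eq_bigr => j -> do rewrite -mulN1r.
  by rewrite big_split/= prodr_const.
have sign0 : (\sum_(J : {set 'I_k}) (-1) ^+ #|J| = 0 :> R)%R.
  transitivity (\prod_(j < k) (1 - 1) : R)%R; last first.
    by rewrite subrr big_const_ord; case: k k0 => //= ? _; rewrite mul0r.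
  rewrite (expand (fun=> 1%R)); apply: eq_bigr => J _.
  by rewrite big1// mulr1.
have unionE J : (\1_(union J) x = 1 - \prod_(j in J) (1 - \1_(D j) x) :> R)%R.
  rewrite indicE; have [[j /= jJ Dx]|nD] := pselect (union J x).
    rewrite mem_set; last by exists j.
    by rewrite (bigD1 j)//= indicE mem_set// subrr mul0r subr0.
  rewrite memNset// big1 ?subrr// => j jJ.
  by rewrite indicE memNset ?subr0// => Dx; apply: nD; exists j.
transitivity (\prod_(j < k) (1 - (1 - \1_(D j) x)) : R)%R.
  by apply: eq_bigr => j _; rewrite subKr.
rewrite (expand (fun j => 1 - \1_(D j) x)%R).
under [RHS]eq_bigr do rewrite unionE mulrBr mulr1 mulNr opprK.
by rewrite big_split/= sumrN sign0 oppr0 add0r.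
Qed.

Let mU J : measurable (union J).
Proof. by apply: fin_bigcup_measurable. Qed.

Lemma measure_bigcup_lty J : m (union J) < +oo.
Proof.
rewrite /union bigcup_pred.
apply: (@proj2 (measurable (\big[setU/set0]_(j in J) D j))).
apply: (big_ind (fun A => measurable A /\ m A < +oo)) => //.
  by rewrite measure0 ltry.
move=> A B [mA fA] [mB fB]; split; first exact: measurableU.
by rewrite (le_lt_trans (measureU2 _ mA mB))// lte_add_pinfty.
Qed.

Let integrable_indic_union J : m.-integrable setT (fun x => (\1_(union J) x)%:E).
Proof.
apply/integrableP; split; first exact/measurable_EFinP/measurable_indic.
under eq_integral do rewrite gee0_abs ?lee_fin//.
by rewrite integral_indic// setIT measure_bigcup_lty.
Qed.

Lemma measure_inclusion_exclusion :
  m (\bigcap_(j in [set: 'I_k]) D j) =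
  \sum_(1 <= r < k.+1) ((-1) ^+ r)%:E *
    \sum_(J : {set 'I_k} | #|J| == r) - m (union J).
Proof.
pose L J := fine (m (union J)).
have LE J : m (union J) = (L J)%:E.
  by rewrite /L fineK// ge0_fin_numE//; exact: measure_bigcup_lty.
transitivity (\sum_(J : {set 'I_k}) (- (-1) ^+ #|J| * L J)%:E).
  rewrite -[X in m X]setIT -integral_indic//; last first.
    by apply: fin_bigcap_measurable.
  transitivity (\int[m]_x \sum_(J : {set 'I_k}) ((- (-1) ^+ #|J|)%:E * (\1_(union J) x)%:E)).
    apply: eq_integral => x _; rewrite sumEFin -prod_indic_inclusion_exclusion.
    rewrite indicE; have [Dx|nD] := pselect ((\bigcap_(j in [set: 'I_k]) D j) x).
      by rewrite mem_set// big1// => j _; rewrite indicE mem_set//; exact: Dx.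
    rewrite memNset//; have /existsNP[j Dj] : ~ forall j, D j x.
      by move=> Dx; apply: nD => j _.
    by rewrite (bigD1 j)//= indicE memNset ?mul0r.
  rewrite integral_sum//.
    apply: eq_bigr => J _; rewrite integralZl//.
    by rewrite integral_indic// setIT EFinM -LE.
  by move=> J; apply: integrableZl.
have cardJ (J : {set 'I_k}) : (#|J| < k.+1)%N.
  by rewrite ltnS (leq_trans (max_card _))// card_ord.
rewrite (partition_big (fun J : {set 'I_k} => inord #|J| : 'I_k.+1) xpredT)//=.
(* The class of cardinality 0 contains only the empty set, whose union is null; hence the sum starts
   at [r = 1]. *)
rewrite big_ord_recl/= big1 ?add0r; last first.
  move=> J /eqP /(congr1 val); rewrite /= (inordK (cardJ J)).
  move=> /cards0_eq ->; rewrite /L /union.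
  by rewrite [X in m X](_ : _ = set0) ?measure0 ?mulr0// bigcup0// => j; rewrite /= inE.
rewrite big_add1/= big_mkord; apply: eq_bigr => r _.
under [in RHS]eq_bigr do rewrite LE -EFinN.
rewrite !sumEFin -EFinM; congr EFin; rewrite mulr_sumr.
apply: eq_big => J; last first.
  move=> /eqP /(congr1 val); rewrite /= (inordK (cardJ J)).
  by move=> ->; rewrite mulrN mulNr.
by rewrite -val_eqE/= inordK.
Qed.

End inclusion_exclusion.

Section frechet.
Context d (T : measurableType d) (R : realType) (P : probability T R).
Variable Z : T -> \bar R.
Hypothesis mZ : measurable_fun setT Z.
Hypothesis frechet : forall a : R, (0 < a)%R ->
  P [set w | Z w <= a%:E] = (expR (- a^-1))%:E.

Let mle (a : \bar R) : measurable [set w | Z w <= a].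
Proof.
by rewrite -[X in measurable X]setTI; apply: emeasurable_fun_infty_c.
Qed.

Let ae_gt0 : P [set w | Z w <= 0] = 0.
Proof.
apply/eqP; rewrite eq_le measure_ge0 andbT; apply/lee_addgt0Pr => e e0.
rewrite add0e (le_trans (_ : _ <= P [set w | Z w <= e%:E]))//.
  apply: le_measure; rewrite ?inE// => w /= /le_trans; apply.
  by rewrite lee_fin ltW.
(* [exp (- 1/e) <= e], because [1/e <= 1 + 1/e <= exp (1/e)]. *)
rewrite frechet// lee_fin expRN -[leRHS]invrK lef_pV2 ?posrE ?expR_gt0 ?invr_gt0//.
by rewrite (le_trans _ (expR_ge1Dx _))// lerDr.
Qed.

Let ae_lty : P [set w | Z w = +oo] = 0.
Proof.
have mZy : measurable [set w | Z w = +oo].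
  by rewrite -[X in measurable X]setTI; apply: (mZ measurableT (Y := [set +oo]));
    exact: emeasurable_set1.
apply/eqP; rewrite eq_le measure_ge0 andbT; apply/lee_addgt0Pr => e e0.
have e10 : (0 < e^-1)%R by rewrite invr_gt0.
rewrite add0e (le_trans (_ : _ <= P (~` [set w | Z w <= (e^-1)%:E])))//.
  apply: le_measure; rewrite ?inE//; first exact: measurableC.
  by move=> w /= ->; rewrite leye_eq.
rewrite [leLHS](probability_setC P (mle _)) frechet// invrK -EFinB lee_fin.
by rewrite lerBlDr addrC -lerBlDr; have := expR_ge1Dx (- e).
Qed.

Lemma frechet_ae : {ae P, forall w, 0 < Z w < +oo}.
Proof.
exists ([set w | Z w <= 0] `|` [set w | Z w = +oo]); split.
- apply: measurableU => //.
  by rewrite -[X in measurable X]setTI; apply: (mZ measurableT (Y := [set +oo]));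
    exact: emeasurable_set1.
- apply/eqP; rewrite eq_le measure_ge0 andbT.
  have mZy : measurable [set w | Z w = +oo].
    by rewrite -[X in measurable X]setTI; apply: (mZ measurableT (Y := [set +oo]));
      exact: emeasurable_set1.
  by rewrite (le_trans (measureU2 _ (mle 0) mZy))// [X in X + _]ae_gt0 add0e [leLHS]ae_lty.
- move=> w /= /negP; rewrite negb_and -!leNgt leye_eq => /orP[?|/eqP ?]; by [left|right].
Qed.

(* Tonelli on [{(w, t) | 0 < t <= 1 / Z w}]: given [t], the event [Z <= 1 / t]
   has probability [exp (- t)]. *)
Lemma integral_inv_frechet (g : T -> \bar R) : measurable_fun setT g ->
  (forall w, 0 <= g w) ->
  (forall w, 0 < Z w < +oo -> g w = ((fine (Z w))^-1)%:E) ->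
  \int[P]_w g w = 1.
Proof.
move=> mg g0 gE.
pose E := [set z : T * R | (0 < z.2)%R /\ Z z.1 <= (z.2 `^ (-1))%:E].
have mE : measurable E.
  rewrite (_ : E = (setT `*` `]0%R, +oo[%classic) `&`
      [set z | Z z.1 <= (z.2 `^ (-1))%:E]); last first.
    apply/seteqP; split => -[w t]; rewrite /E /= in_itv/= andbT.
      by move=> [t0 Zt]; split.
    by move=> [[_ t0] Zt].
  apply: measurableI; first by apply: measurableX => //; exact: measurable_itv.
  rewrite -[X in measurable X]setTI; apply: measurable_lee => //.
    exact: measurableT_comp.
  apply/measurable_EFinP; apply: (measurableT_comp (measurable_powR (-1))).
  exact: measurable_snd.
transitivity (\int[P]_w lebesgue_measure (xsection E w)).
  apply: ge0_ae_eq_integral => //; first exact: measurable_fun_xsection.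
  apply: filterS frechet_ae => w Zw _; rewrite gE//.
  have /andP[Z0 Zy] := Zw.
  have ZE : Z w = (fine (Z w))%:E by rewrite fineK// ge0_fin_numE// ltW.
  have r0 : (0 < fine (Z w))%R by rewrite fine_gt0// Z0.
  set r := fine (Z w) in ZE r0 *.
  rewrite (_ : xsection E w = `]0%R, r^-1%R]%classic).
    by rewrite lebesgue_measure_itv/= lte_fin invr_gt0 r0 sube0.
  apply/seteqP; split => t /=; rewrite in_itv/=.
    move=> /xsectionP[/= t0]; rewrite t0/= ZE lee_fin (powR_inv1 (ltW t0)) => h.
    by rewrite -[t]invrK lef_pV2 ?posrE ?invr_gt0.
  move=> /andP[t0 h]; apply/xsectionP; split => //=.
  by rewrite ZE lee_fin (powR_inv1 (ltW t0)) -[leLHS]invrK lef_pV2 ?posrE ?invr_gt0.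
transitivity (\int[lebesgue_measure]_t P (ysection E t)).
  have := indic_fubini_tonelli P lebesgue_measure mE.
  by rewrite indic_fubini_tonelli_FE// indic_fubini_tonelli_GE.
(* The integral of [exp (- t)] over [t > 0] is read as the total mass of the exponential density of
   rate 1. The integrands are compared off [t = 0], where the section of [E] is empty. *)
rewrite -(@integral_exponential_pdf R 1)//.
apply: ge0_ae_eq_integral => //.
- exact: measurable_fun_ysection.
- by apply/measurable_EFinP; exact: measurable_exponential_pdf.
- by move=> t _; rewrite lee_fin exponential_pdf_ge0.
exists [set 0%R]; split; [exact: measurable_set1|exact: lebesgue_measure_set1|].
move=> t /= h; apply: contrapT => t0; apply: h => _.
have [tp|tn|t0'] := ltrgtP 0%R t; last by case: t0.
- rewrite exponential_pdfE ?ltW// mul1r mulN1r -[in RHS](invrK t).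
  rewrite -frechet ?invr_gt0//; congr (P _).
  apply/seteqP; split => w /=; first by move=> /ysectionP[_ /=]; rewrite powR_inv1// ltW.
  by move=> h; apply/ysectionP; split => //=; rewrite powR_inv1// ltW.
- rewrite lt0_exponential_pdf// (_ : ysection E t = set0) ?measure0//.
  by apply/seteqP; split => w // /ysectionP[/=]; rewrite ltNge (ltW tn).
Qed.

End frechet.

(** * Spectral representations *)

(** The generators of [cylinder], named so that the path space becomes a measurable type. A process
    is then a measurable map into it, and its law can serve as the mark distribution. *)
Definition path_generators (S : Type) d' (U : measurableType d') (X : set S) :
    set (set (S -> U)) :=
  [set C | exists2 s, X s &
    exists2 B : set U, measurable B & C = [set f | B (f s)]].

Section path_space.
Context (S : Type) d' (U : measurableType d') (X : set S).

Lemma measurable_path d (T : measurableType d) (Z : T -> S -> U) :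
  is_process X Z ->
  measurable_fun setT (Z : T -> g_sigma_algebraType (@path_generators S d' U X)).
Proof. by move=> mZ _ C mC; rewrite setTI; exact: (measurable_cylinder mZ). Qed.

Lemma measurable_eval s : X s -> measurable_fun setT
  (fun f : g_sigma_algebraType (@path_generators S d' U X) => f s).
Proof.
by move=> Xs _ B mB; rewrite setTI; apply: sub_sigma_algebra; exists s => //; exists B.
Qed.

End path_space.

Lemma measurable_lne (R : realType) : measurable_fun setT (@lne R).
Proof.
have -> : @lne R = fun x => if x <= 0 then -oo else
    if +oo <= x then +oo else (ln (fine x))%:E.
  apply/funext => -[r| |]; rewrite /= ?leey ?leNye//.
apply: measurable_fun_ifT => //; first exact: measurable_fun_lee.
apply: measurable_fun_ifT => //; first exact: measurable_fun_lee.
apply/measurable_EFinP; apply: (measurableT_comp (@measurable_ln R)).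
exact: fine_measurable.
Qed.

Section spectral.
Context (R : realType) (n : nat) (X : set 'rV[R]_n).
Context d0 (T0 : measurableType d0) (P0 : probability T0 R) (Y : T0 -> 'rV[R]_n -> R).
Context d (T : measurableType d) (P : probability T R).
Variables (zeta : T -> nat -> R) (Ys : nat -> T -> 'rV[R]_n -> R).
Hypothesis hspec : spectral_representation X P0 Y P zeta Ys.

Local Notation U := (g_sigma_algebraType (@path_generators 'rV[R]_n _ R X)).

Let mY : measurable_fun setT (Y : T0 -> U).
Proof. by apply: measurable_path; have [] := spectral_process hspec. Qed.

Let Ym : {mfun T0 >-> U} := HB.pack (Y : T0 -> U) (isMeasurableFun.Build _ _ _ _ _ mY).

Let Q : probability U R := distribution P0 Ym.

Let m : {sigma_finite_measure set (R * U)%type -> \bar R} := sigma_finite_product (@inv_sq R) Q.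

Let phi i w : R * U := (zeta w i, Ys i w).

Let mYs i : measurable_fun setT (Ys i : T -> U).
Proof. by apply: measurable_path; have [[]] := spectral_copies hspec i. Qed.

Let mphi i : measurable_fun setT (phi i).
Proof.
apply: measurable_fun_pair => //.
exact: (poisson_points (spectral_poisson hspec)).
Qed.

Let generating_functional (h : R * U -> R) : measurable_fun setT h ->
  (forall v, 0 <= h v <= 1)%R ->
  \int[P]_w (\prod_(i < N) h (phi i w))%:E @[N --> \oo] -->
  expeR (- \int[m]_v (1 - h v)%:E).
Proof.
move=> mh h01.
apply: (@cvg_integral_prod_marked _ T _ U R P Q [set z : R | (0 < z)%R]
  (@inv_sq_measure R) zeta (@inv_sq R) Ys _ _ _ _ _ _ _ h mh h01).
- by rewrite (_ : [set z | _] = `]0%R, +oo[%classic)//;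
    apply/seteqP; split => z /=; rewrite in_itv/= andbT.
- exact: spectral_poisson hspec.
- by move=> B _ BD; exact: inv_sq_subE.
- exact: inv_sq_setC.
- by move=> i; exact: mYs.
- by move=> i B mB; have [_] := spectral_copies hspec i; exact.
- exact: spectral_independent hspec.
Qed.

Let coord s (v : R * U) : R := (v.1 * v.2 s)%R.

Let mcoord s : X s -> measurable_fun setT (coord s).
Proof.
move=> Xs; apply: measurable_funM => //.
by apply: (measurableT_comp (measurable_eval Xs)).
Qed.

(** For a fixed path the section is [z > a / Y w s], of mass [Y w s / a], or empty when [Y w s = 0].
    Its expectation is [1 / a] since [Y] has mean 1 at [s]. *)
Let intensity_gt s a : X s -> (0 < a)%R ->
  m [set v | (a < coord s v)%R] = (a^-1)%:E.
Proof.
move=> Xs a0; set C := [set v | _].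
have mC : measurable C.
  rewrite (_ : C = coord s @^-1` `]a, +oo[%classic).
    by rewrite -[X in measurable X]setTI; apply: mcoord.
  by apply/seteqP; split => v; rewrite /C /= in_itv/= andbT.
have := indic_fubini_tonelli (@inv_sq R) Q mC.
rewrite indic_fubini_tonelli_FE// indic_fubini_tonelli_GE// => mE.
rewrite [LHS]mE ge0_integral_distribution//=; last exact: measurable_fun_ysection.
transitivity (\int[P0]_w ((a^-1)%:E * (Y w s)%:E)).
  apply: eq_integral => w _ /=.
  have [_ Y0 _] := spectral_process hspec.
  have := Y0 w s Xs; rewrite le_eqVlt => /predU1P[Ys0|Ysp].
    rewrite -Ys0 mule0 (_ : ysection C (Y w) = set0) ?measure0//.
    apply/seteqP; split => z // /ysectionP.
    by rewrite /C /coord/= -Ys0 mulr0 ltNge (ltW a0).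
  rewrite -EFinM (_ : ysection C (Y w) = `](a / Y w s)%R, +oo[%classic).
    by rewrite inv_sq_itv_infty ?divr_gt0// invf_div mulrC.
  apply/seteqP; split => z /=; rewrite in_itv/= andbT ltr_pdivrMr//.
    by move=> /ysectionP.
  by move=> h; exact/ysectionP.
rewrite ge0_integralZl//.
- by rewrite (spectral_mean hspec)// mule1.
- by apply/measurable_EFinP; have [mY' _ _] := spectral_process hspec; exact: mY'.
- by move=> w _; rewrite lee_fin; have [_ Y0 _] := spectral_process hspec; exact: Y0.
- by rewrite lee_fin invr_ge0 ltW.
Qed.

Variables (eta eta' : T -> 'rV[R]_n -> \bar R).
Hypothesis heta : forall w s, X s ->
  eta w s = max_process (spectral_fun zeta Ys) w s.
Hypothesis heta' : independent_copy P X eta eta'.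

Let meta' s : X s -> measurable_fun setT (fun w => eta' w s).
Proof. by have [+ _ _] := heta'; exact. Qed.

Let eta_leP s w (a : \bar R) : X s ->
  eta w s <= a <-> forall i, (coord s (phi i w))%:E <= a.
Proof.
move=> Xs; rewrite heta// /max_process; split.
  by move=> h i; apply: le_trans h; apply: ereal_sup_ubound; exists i.
by move=> h; apply/ereal_supP => _ [i _ <-]; exact: h.
Qed.

Let measurable_exceed (K : finType) (s : K -> 'rV[R]_n) (J : {set K}) (a : K -> R) :
  (forall j, X (s j)) ->
  measurable [set v | forall j, j \in J -> (coord (s j) v <= a j)%R].
Proof.
move=> Xs; rewrite (_ : [set v | _] = \bigcap_(j in [set` J])
    coord (s j) @^-1` `]-oo, a j]%classic); last first.
  by apply/seteqP; split => v h j /= jJ; have := h j jJ; rewrite /= in_itv.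
apply: fin_bigcap_measurable => // j _.
by rewrite -[X in measurable X]setTI; exact: mcoord.
Qed.

Let prob_eta_le (K : finType) (s : K -> 'rV[R]_n) (J : {set K}) (a : K -> R) :
  (forall j, X (s j)) ->
  P [set w | forall j, j \in J -> eta w (s j) <= (a j)%:E] =
  expeR (- m [set v | exists2 j, j \in J & (a j < coord (s j) v)%R]).
Proof.
move=> Xs.
have := void_probability mphi generating_functional (measurable_exceed J a Xs).
rewrite (_ : ~` _ = [set v | exists2 j, j \in J & (a j < coord (s j) v)%R]); last first.
  apply/seteqP; split => v /=.
    by move=> /existsNP[j /not_implyP[jJ /negP]]; rewrite -ltNge => ?; exists j.
  by move=> [j jJ]; rewrite ltNge => /negP h /(_ j jJ).
move=> <-; congr (P _); apply/seteqP; split => w /=.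
  by move=> h i j jJ; rewrite -lee_fin; move/(eta_leP _ _ (Xs j)): (h j jJ).
by move=> h j jJ; apply/(eta_leP _ _ (Xs j)) => i; rewrite lee_fin; exact: h.
Qed.

Let prob_eta'_le (K : finType) (s : K -> 'rV[R]_n) (J : {set K}) (a : K -> R) :
  (forall j, X (s j)) ->
  P [set w | forall j, j \in J -> eta' w (s j) <= (a j)%:E] =
  P [set w | forall j, j \in J -> eta w (s j) <= (a j)%:E].
Proof.
move=> Xs; have [_ law _] := heta'.
have := law [set f | forall j, j \in J -> f (s j) <= (a j)%:E].
apply; rewrite (_ : [set f | _] = \bigcap_(j in [set` J])
    [set f : 'rV[R]_n -> \bar R | f (s j) <= (a j)%:E])//.
apply: (@fin_bigcap_measurable _
  (g_sigma_algebraType (@path_generators 'rV[R]_n _ (\bar R) X))) => // j _.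
apply: sub_sigma_algebra; exists (s j) => //.
exists `]-oo, (a j)%:E]%classic; first exact: emeasurable_itv.
by apply/seteqP; split => f /=; rewrite in_itv.
Qed.

Let frechet' s a : X s -> (0 < a)%R ->
  P [set w | eta' w s <= a%:E] = (expR (- a^-1))%:E.
Proof.
move=> Xs a0.
have h1 := @prob_eta'_le unit (fun=> s) [set: unit]%SET (fun=> a) (fun=> Xs).
have h2 := @prob_eta_le unit (fun=> s) [set: unit]%SET (fun=> a) (fun=> Xs).
transitivity (P [set w | forall j : unit, j \in [set: unit]%SET -> eta' w s <= a%:E]).
  congr (P _); apply/seteqP; split => w /=; first by [].
  by move=> h; apply: (h tt); rewrite inE.
rewrite h1 h2 (_ : [set v | _] = [set v | (a < coord s v)%R]) ?intensity_gt//.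
apply/seteqP; split => v /=; first by case.
by exists tt => //; rewrite inE.
Qed.

(** The second conjunct matches the dyadic cells, which cover only positive values. *)
Let exceed s : set (T * (R * U)) :=
  [set z | eta' z.1 s < (coord s z.2)%:E /\ (0 < coord s z.2)%R].

Let measurable_exceed' s : X s -> measurable (exceed s).
Proof.
move=> Xs.
have mc : measurable_fun setT (fun z : T * (R * U) => coord s z.2).
  exact: (measurableT_comp (mcoord Xs)).
rewrite (_ : exceed s = [set z | eta' z.1 s < (coord s z.2)%:E] `&`
  [set z | 0%:E < (coord s z.2)%:E])//.
apply: measurableI; rewrite -[X in measurable X]setTI; apply: measurable_lte => //.
- exact: (measurableT_comp (meta' Xs)).
- exact/measurable_EFinP.
- exact/measurable_EFinP.
Qed.

(** For almost every path of [eta'] the section has mass [1 / eta'(s)], the inverse of a unit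
    Frechet variable, whose mean is 1. *)
Let intensity_exceed s : X s -> (P \x m) (exceed s) = 1.
Proof.
move=> Xs; apply: (integral_inv_frechet (meta' Xs)) => //.
- by move=> a; exact: frechet'.
- by apply: measurable_fun_xsection; exact: measurable_exceed'.
move=> w /andP[e0 ey].
have fE : eta' w s \is a fin_num by rewrite ge0_fin_numE// ltW.
have f0 : (0 < fine (eta' w s))%R by rewrite fine_gt0// e0.
rewrite -(intensity_gt Xs f0); congr (m _); apply/seteqP; split => v /=.
  by move=> /xsectionP[/= + _]; rewrite -{1}(fineK fE) lte_fin.
move=> h; apply/xsectionP; split => /=; first by rewrite -(fineK fE) lte_fin.
exact: lt_trans h.
Qed.

Let eta_eqP l w s : X s -> eta w s = (spectral_fun zeta Ys l w s)%:E <->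
  forall i, (coord s (phi i w) <= coord s (phi l w))%R.
Proof.
move=> Xs; split=> [E i|H].
  by rewrite -lee_fin; move: i; apply/(eta_leP w _ Xs); rewrite E.
apply/eqP; rewrite eq_le; apply/andP; split.
  by apply/(eta_leP w _ Xs) => i; rewrite lee_fin; exact: H.
by have /(eta_leP w _ Xs)/(_ l) := lexx (eta w s).
Qed.

(** The index type is left general: [unit] gives uniqueness of the maximum at one site, and ['I_k]
    gives concurrence. *)
Let strict_prob (K : finType) (s : K -> 'rV[R]_n) : set T :=
  \bigcup_q strictly_dominated phi (fun j => coord (s j)) q.

Let strict_probE (K : finType) (i0 : K) (s : K -> 'rV[R]_n) :
  (forall j, X (s j)) ->
  P (strict_prob s) = (P \x m) [set z | forall j, exceed (s j) z].
Proof.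
move=> Xs; apply: (strict_domination_probability mphi generating_functional i0
  (eta := fun j w => eta' w (s j))).
- by move=> j; exact: mcoord.
- by move=> j; exact: meta'.
move=> a; have h1 := @prob_eta'_le K s [set: K]%SET a Xs.
transitivity (P [set w | forall j, j \in [set: K]%SET -> eta' w (s j) <= (a j)%:E]).
  by congr (P _); apply/seteqP; split => w /= H j; [move=> _|]; apply: H; rewrite ?inE.
rewrite h1; congr (P _); apply/seteqP; split => w /= H.
  move=> i j; rewrite -lee_fin; move: i; apply/(eta_leP w _ (Xs j)).
  by apply: H; rewrite inE.
by move=> j _; apply/(eta_leP w _ (Xs j)) => i; rewrite lee_fin; exact: H.
Qed.

Let strict1 s : set T := @strict_prob unit (fun=> s).

Let strict1_ae s : X s -> {ae P, forall w, strict1 s w}.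
Proof.
move=> Xs; have m1 : measurable (strict1 s).
  apply: bigcupT_measurable => q; apply: measurable_strictly_dominated => //.
  by move=> _; exact: mcoord.
have P1 : P (strict1 s) = 1.
  rewrite (strict_probE tt (fun=> Xs)) (_ : [set z | _] = exceed s).
    exact: intensity_exceed.
  by apply/seteqP; split => z /= H; [exact: (H tt)|].
exists (~` strict1 s); split => //; first exact: measurableC.
by have := probability_setC P m1; rewrite P1 subee.
Qed.

Section sites.
Variables (k : nat) (s : 'I_k -> 'rV[R]_n).
Hypothesis k0 : (0 < k)%N.
Hypothesis Xs : forall j, X (s j).

Let union (J : {set 'I_k}) := \bigcup_(j in [set` J]) exceed (s j).

Let munion J : measurable (union J).
Proof. by apply: fin_bigcup_measurable => // j _; exact: measurable_exceed'. Qed.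

Lemma expected_log_probE J : expected_log_prob P eta eta' s J = - (P \x m) (union J).
Proof.
have mex : measurable [set z : T * T | forall j, j \in J -> eta z.2 (s j) <= eta' z.1 (s j)].
  (* Joint measurability is obtained by replacing [eta] with the individual points, of which it is
     the supremum on [X]. *)
  rewrite (_ : [set z | _] = \bigcap_(j in [set` J]) \bigcap_(i in [set: nat])
     [set z : T * T | (coord (s j) (phi i z.2))%:E <= eta' z.1 (s j)]); last first.
    apply/seteqP; split => z h j jJ.
      by move=> i _; move/(eta_leP _ _ (Xs j)): (h j jJ); exact.
    by apply/(eta_leP _ _ (Xs j)) => i; exact: h.
  apply: fin_bigcap_measurable => // j _; apply: bigcap_measurableType => i _.
  rewrite -[X in measurable X]setTI; apply: measurable_lee => //.
    apply/measurable_EFinP; apply: (measurableT_comp (mcoord (Xs j))).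
    exact: (measurableT_comp (mphi i)).
  exact: (measurableT_comp (meta' (Xs j))).
pose h w' := P (xsection [set z : T * T |
  forall j, j \in J -> eta z.2 (s j) <= eta' z.1 (s j)] w').
have hE w' : P [set w | forall j, j \in J -> eta w (s j) <= eta' w' (s j)] = h w'.
  by congr (P _); apply/seteqP; split => w /= H; [exact/xsectionP|by move/xsectionP: H].
rewrite /expected_log_prob; under eq_integral do rewrite hE.
rewrite [in RHS]/product_measure1 -integral_ge0N//.
apply: ae_eq_integral => //.
- apply: (measurableT_comp (@measurable_lne R)); exact: measurable_fun_xsection.
- apply: measurableT_comp => //; exact: measurable_fun_xsection.
have : {ae P, forall w', forall j : 'I_k, 0 < eta' w' (s j) < +oo}.
  apply: filter_forall => j; apply: frechet_ae; first exact: meta'.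
  by move=> a; exact: frechet'.
apply: filterS => w' e0y _; rewrite -hE.
have eE j : eta' w' (s j) = (fine (eta' w' (s j)))%:E.
  by have /andP[e0 ey] := e0y j; rewrite fineK// ge0_fin_numE// ltW.
transitivity (lne (P [set w | forall j, j \in J ->
    eta w (s j) <= (fine (eta' w' (s j)))%:E])).
  congr (lne (P _)); apply/seteqP; split => w /= H j /H; first by rewrite {1}eE.
  by rewrite -eE.
rewrite prob_eta_le// expeRK; congr (- m _); apply/seteqP; split => v /=.
  move=> [j jJ H]; apply/xsectionP; exists j => //; split => /=.
    by rewrite eE lte_fin.
  by apply: lt_trans H; rewrite -lte_fin -eE; have /andP[] := e0y j.
move=> /xsectionP[j /= jJ [/= + _]]; rewrite eE lte_fin => H.
by exists j.
Qed.

(** Strict domination implies concurrence. Conversely, off a null set each site has a strict winner,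
    and a point attaining the maximum at all sites must be that winner at each of them. *)
Lemma concurrence_probE : concurrence_prob P (spectral_fun zeta Ys) eta s =
  (P \x m) (\bigcap_(j in [set: 'I_k]) exceed (s j)).
Proof.
rewrite (_ : \bigcap_(j in _) _ = [set z | forall j, exceed (s j) z]); last first.
  by apply/seteqP; split => z H j; [exact: H|move=> _; exact: H].
rewrite -(strict_probE (Ordinal k0) Xs) /concurrence_prob.
set C := [set w | _].
have CE : C = \bigcup_l \bigcap_(j in [set: 'I_k]) \bigcap_i
    [set w | (coord (s j) (phi i w) <= coord (s j) (phi l w))%R].
  apply/seteqP; split => w.
    move=> [l H]; exists l => // j _ i _.
    by have /(eta_eqP l w (Xs j)) h := H j; exact: h.
  by move=> [l _ H]; exists l => j; apply/(eta_eqP l w (Xs j)) => i; exact: (H j I i I).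
have mC : measurable C.
  rewrite CE; apply: bigcupT_measurable => l; apply: fin_bigcap_measurable => // j _.
  apply: bigcap_measurableType => i _; rewrite -[X in measurable X]setTI.
  by apply: measurable_fun_le => //; apply: (measurableT_comp (mcoord (Xs j))).
set S := strict_prob s.
have mS : measurable S.
  apply: bigcupT_measurable => q; apply: measurable_strictly_dominated => //.
  by move=> j; exact: mcoord.
apply/eqP; rewrite eq_le; apply/andP; split; last first.
  apply: le_measure; rewrite ?inE// CE.
  move=> w [q _ [l H]]; exists l => // j _ i _.
  have [->|il] := eqVneq i l; first exact: lexx.
  have [p /andP[pl _] pi] := H j.
  exact: le_trans (pi i il) (ltW pl).
have [N [mN N0 CN]] : {ae P, forall w, forall j : 'I_k, strict1 (s j) w}.
  by apply: filter_forall => j; exact: strict1_ae.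
apply: (@le_trans _ _ (P (S `|` N))).
  apply: le_measure; rewrite ?inE//; first exact: measurableU.
  move=> w; rewrite CE => -[l _ H].
  have [Nw|nN] := pselect (N w); [by right|left].
  have S1 : forall j : 'I_k, strict1 (s j) w.
    by apply: contrapT => nS; apply: nN; exact: CN.
  have /choice[q qP] : forall j, exists q, strict_gap phi (fun j => coord (s j)) q l j w.
    (* [l'] is the strict winner at the site [s j] alone; if it differed from [l], the value of
       [phi l] there would be strictly smaller, against its maximality. *)
    move=> j; have [q _ [l' /(_ tt) [p pl' pi]]] := S1 j.
    exists q; have [ll'|ll'] := eqVneq l l'; first by rewrite ll'; exists p.
    have := H j I l' I; move: pl' => /andP[+ _] /=.
    by move=> /(le_lt_trans (pi l ll'))/lt_le_trans/[apply]; rewrite ltxx.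
  exists (\max_j q j)%N => //; exists l => j.
  by apply: strict_gap_homo (qP j); exact: leq_bigmax.
by rewrite (le_trans (measureU2 _ mS mN))// [X in _ + X]N0 adde0.
Qed.

Lemma concurrence_inclusion_exclusion :
  concurrence_prob P (spectral_fun zeta Ys) eta s =
  \sum_(1 <= r < k.+1) ((-1) ^+ r)%:E *
    \sum_(J : {set 'I_k} | #|J| == r) expected_log_prob P eta eta' s J.
Proof.
rewrite concurrence_probE measure_inclusion_exclusion//; last 2 first.
- by move=> j; exact: measurable_exceed'.
- by move=> j; rewrite [ltLHS]intensity_exceed ?ltry.
by apply: eq_bigr => r _; congr (_ * _); apply: eq_bigr => J _; rewrite expected_log_probE.
Qed.

Lemma expected_log_prob_set1 j : expected_log_prob P eta eta' s [set j]%SET = -1%E.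
Proof.
rewrite expected_log_probE /union (_ : \bigcup_(i in _) _ = exceed (s j)).
  by congr (- _); exact: intensity_exceed.
apply/seteqP; split => z; first by move=> [i /= /set1P ->].
by exists j => //=; rewrite inE.
Qed.

End sites.

End spectral.

Unset Implicit Arguments.
Set Strict Implicit.

Theorem theorem3 (R : realType) (n : nat) (hn : (1 <= n)%N)
    (X : set 'rV[R]_n) (cX : compact X)
    (d0 : measure_display) (T0 : measurableType d0) (P0 : probability T0 R)
    (Y : T0 -> 'rV[R]_n -> R)
    (d : measure_display) (T : measurableType d) (P : probability T R)
    (zeta : T -> nat -> R) (Ys : nat -> T -> 'rV[R]_n -> R)
    (hspec : spectral_representation X P0 Y P zeta Ys)
    (eta eta' : T -> 'rV[R]_n -> \bar R)
    (heta : forall w s, X s ->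
      eta w s = max_process (spectral_fun zeta Ys) w s)
    (heta' : independent_copy P X eta eta') :
  (forall (k : nat) (s : 'I_k -> 'rV[R]_n), (2 <= k)%N ->
    (forall j, X (s j)) ->
    concurrence_prob P (spectral_fun zeta Ys) eta s =
    \sum_(1 <= r < k.+1) ((-1) ^+ r)%:E *
      \sum_(J : {set 'I_k} | #|J| == r) expected_log_prob P eta eta' s J) /\
  (forall s : 'I_2 -> 'rV[R]_n, (forall j, X (s j)) ->
    concurrence_prob P (spectral_fun zeta Ys) eta s =
    2%:E + expected_log_prob P eta eta' s [set: 'I_2]%SET).
Proof.
split=> [k s k2 Xs|s Xs].
  exact: (concurrence_inclusion_exclusion hspec heta heta' (ltnW k2) Xs).
rewrite (concurrence_inclusion_exclusion hspec heta heta' (ltn0Sn 1) Xs).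
rewrite big_nat_recr//= big_nat1 expr1 sqrrN expr1n mul1e; congr (_ + _).
  (* Each of the two singletons contributes [-1], and the sign for [r = 1] turns their sum into the
     constant 2. *)
  rewrite (eq_bigr (fun=> -1%E)); last first.
    by move=> J /cards1P[j ->]; exact: (expected_log_prob_set1 hspec heta heta' Xs).
  rewrite big_const -cardsE card_draws card_ord bin1 /= adde0.
  by rewrite -EFinD -EFinM; congr EFin; ring.
rewrite (big_pred1 [set: 'I_2]%SET)// => J /=.
rewrite eqEcard finset.subsetT cardsT card_ord /= eqn_leq.
by have := max_card (mem J); rewrite card_ord => ->.
Qed.
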